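(* Let $N$ be a submanifold of a Kaehlerian manifold $(M,g,J)$. Then: (i) For any vectors $X,Y$ tangent to $N$, $$(\nabla_XP)Y=t\,h(X,Y)+A_{FY}X.$$ Hence $\nabla P=0$ if and only if $A_{FX}Y=A_{FY}X$ for all $X,Y$ tangent to $N$. (ii) For any vectors $X,Y$ tangent to $N$, $$(\nabla_XF)Y=f\,h(X,Y)-h(X,PY).$$ Hence $\nabla F=0$ if and only if $A_{f\xi}X=-A_\xi(PX)$ for every normal vector $\xi$ and tangent vector $X$ of $N$.
   Context: $N$ carries the induced metric, $\nabla$ is its Levi-Civita connection, $D$ the normal connection, $h$ the second fundamental form and $A$ the Weingarten map, $\langle A_\xi X,Y\rangle=\langle h(X,Y),\xi\rangle$. For $X$ tangent to $N$ write $JX=PX+FX$ with $PX$ tangent and $FX$ normal; for $\xi$ normal to $N$ write $J\xi=t\xi+f\xi$ with $t\xi$ tangent and $f\xi$ normal. Define $(\nabla_XP)Y=\nabla_X(PY)-P(\nabla_XY)$ and $(\nabla_XF)Y=D_X(FY)-F(\nabla_XY)$. *)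

(* Defs.v *)
From HB Require Import structures.
From mathcomp Require Import all_boot all_order all_algebra.
From mathcomp Require Import all_classical all_reals all_analysis.

Set Implicit Arguments.
Unset Strict Implicit.
Unset Printing Implicit Defensive.

Import Order.TTheory GRing.Theory Num.Theory numFieldNormedType.Exports.
Local Open Scope classical_set_scope.
Local Open Scope ring_scope.

Fixpoint Ck_on (R : realType) (V W : normedModType R) (k : nat) (U : set V)
    (f : V -> W) : Prop :=
  if k is k'.+1 then
    (forall x, U x -> differentiable f x) /\
    (forall v : V, Ck_on k' U (fun x => 'D_v f x))
  else forall x, U x -> {for x, continuous f}.

Definition smooth_on (R : realType) (V W : normedModType R) (U : set V)
    (f : V -> W) : Prop := forall k, Ck_on k U f.

(** * Smooth manifolds *)

(* [chart_inv] is meaningful only on the image of [chart_dom]. *)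
Record chart (R : realType) (m : nat) (T : topologicalType) := Chart {
  chart_dom : set T;
  chart_map : T -> 'rV[R]_m;
  chart_inv : 'rV[R]_m -> T;
  chart_dom_open : open chart_dom;
  chart_im_open : open (chart_map @` chart_dom);
  chart_mapK : forall q, chart_dom q -> chart_inv (chart_map q) = q;
  chart_map_cont : forall q, chart_dom q -> {for q, continuous chart_map};
  chart_inv_cont : forall x, (chart_map @` chart_dom) x ->
    {for x, continuous chart_inv} }.

(* The atlas is given as a family [chart_at] of charts indexed by the points,
   the chart [chart_at p] being defined around p.  The tangent space at p is
   'rV[R]_m, a tangent vector being written in the basis of coordinate vectors
   of the chart [chart_at p] at p.  A vector field is thus a function
   M -> 'rV[R]_m, its value at q being expressed in the chart at q. *)
Record manifold (R : realType) (m : nat) := Manifold {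
  mcarrier :> topologicalType;
  mhausdorff : hausdorff_space mcarrier;
  msecond_countable : @second_countable mcarrier;
  chart_at : mcarrier -> chart R m mcarrier;
  chart_at_dom : forall p, chart_dom (chart_at p) p;
  chart_at_compat : forall p q,
    smooth_on (chart_map (chart_at p) @`
                 (chart_dom (chart_at p) `&` chart_dom (chart_at q)))
              (chart_map (chart_at q) \o chart_inv (chart_at p)) }.

Definition phi (R : realType) (m : nat) (M : manifold R m) (p : M) :
  M -> 'rV[R]_m := chart_map (chart_at p).

Definition psi (R : realType) (m : nat) (M : manifold R m) (p : M) :
  'rV[R]_m -> M := chart_inv (chart_at p).

Definition smooth_near (R : realType) (m : nat) (M : manifold R m)
    (W : normedModType R) (p : M) (f : M -> W) : Prop :=
  exists U : set 'rV[R]_m,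
    [/\ open U, U (phi p p) & smooth_on U (f \o psi p)].

(* derivative v(f) of f at p in the direction of the tangent vector v *)
Definition dir_deriv (R : realType) (m : nat) (M : manifold R m)
    (W : normedModType R) (p : M) (v : 'rV[R]_m) (f : M -> W) : W :=
  'D_v (f \o psi p) (phi p p).

(* components of a vector w tangent at q in the coordinate basis of the chart
   around p *)
Definition components (R : realType) (m : nat) (M : manifold R m) (p q : M)
    (w : 'rV[R]_m) : 'rV[R]_m := dir_deriv q w (phi p).

(* the vector field with constant components w in the chart around p; only its
   values on the domain of that chart are meaningful *)
Definition coord_field (R : realType) (m : nat) (M : manifold R m) (p : M)
    (w : 'rV[R]_m) : M -> 'rV[R]_m :=
  fun q => 'D_w (phi q \o psi p) (phi p q).

Definition smooth_field_near (R : realType) (m : nat) (M : manifold R m)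
    (p : M) (Y : M -> 'rV[R]_m) : Prop :=
  smooth_near p (fun q => components p q (Y q)).

(** * Metrics and connections *)

Record is_riemannian (R : realType) (m : nat) (M : manifold R m)
    (g : M -> 'rV[R]_m -> 'rV[R]_m -> R) : Prop := IsRiemannian {
  metric_linear : forall p a u v w,
    g p (a *: u + v) w = a * g p u w + g p v w;
  metric_sym : forall p u v, g p u v = g p v u;
  metric_pos : forall p u, u != 0 -> 0 < g p u u;
  metric_smooth : forall p X Y,
    smooth_field_near p X -> smooth_field_near p Y ->
    smooth_near p (fun q => g q (X q) (Y q) : R^o) }.

(* [nabla p X Y] is the covariant derivative at p, in the direction of the
   tangent vector X, of a vector field Y defined and smooth around p. *)
Record is_connection (R : realType) (m : nat) (M : manifold R m)
    (nabla : M -> 'rV[R]_m -> (M -> 'rV[R]_m) -> 'rV[R]_m) : Prop :=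
  IsConnection {
  conn_local : forall p X Y Z,
    smooth_field_near p Y -> (\forall q \near p, Y q = Z q) ->
    nabla p X Y = nabla p X Z;
  conn_linear : forall p a X X' Y, smooth_field_near p Y ->
    nabla p (a *: X + X') Y = a *: nabla p X Y + nabla p X' Y;
  conn_add : forall p X Y Z,
    smooth_field_near p Y -> smooth_field_near p Z ->
    nabla p X (fun q => Y q + Z q) = nabla p X Y + nabla p X Z;
  conn_leibniz : forall p X (f : M -> R^o) Y,
    smooth_near p f -> smooth_field_near p Y ->
    nabla p X (fun q => (f q : R) *: Y q)
    = (dir_deriv p X f : R) *: Y p + (f p : R) *: nabla p X Y;
  conn_smooth : forall p X Y,
    smooth_field_near p X -> smooth_field_near p Y ->
    smooth_field_near p (fun q => nabla q (X q) Y) }.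

(* The second condition says that the torsion vanishes: nabla_X Y - nabla_Y X
   acts on functions as the bracket [X, Y]. *)
Record is_levi_civita (R : realType) (m : nat) (M : manifold R m)
    (g : M -> 'rV[R]_m -> 'rV[R]_m -> R)
    (nabla : M -> 'rV[R]_m -> (M -> 'rV[R]_m) -> 'rV[R]_m) : Prop :=
  IsLeviCivita {
  lc_connection : is_connection nabla;
  lc_torsion_free : forall p X Y (f : M -> R^o),
    smooth_field_near p X -> smooth_field_near p Y -> smooth_near p f ->
    dir_deriv p (nabla p (X p) Y - nabla p (Y p) X) f
    = dir_deriv p (X p) (fun q => dir_deriv q (Y q) f)
      - dir_deriv p (Y p) (fun q => dir_deriv q (X q) f);
  lc_metric : forall p X Y Z,
    smooth_field_near p Y -> smooth_field_near p Z ->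
    dir_deriv p X (fun q => g q (Y q) (Z q) : R^o)
    = g p (nabla p X Y) (Z p) + g p (Y p) (nabla p X Z) }.

(* Kaehlerian manifold (M, g, J), with Levi-Civita connection nabla: almost
   Hermitian with parallel J. *)
Record is_kaehlerian (R : realType) (m : nat) (M : manifold R m)
    (g : M -> 'rV[R]_m -> 'rV[R]_m -> R) (J : M -> 'rV[R]_m -> 'rV[R]_m)
    (nabla : M -> 'rV[R]_m -> (M -> 'rV[R]_m) -> 'rV[R]_m) : Prop :=
  IsKaehlerian {
  kaehler_riemannian : is_riemannian g;
  kaehler_levi_civita : is_levi_civita g nabla;
  kaehler_linear : forall p a u v, J p (a *: u + v) = a *: J p u + J p v;
  kaehler_smooth : forall p Y,
    smooth_field_near p Y -> smooth_field_near p (fun q => J q (Y q));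
  kaehler_square : forall p u, J p (J p u) = - u;
  kaehler_hermitian : forall p u v, g p (J p u) (J p v) = g p u v;
  kaehler_parallel : forall p X Y, smooth_field_near p Y ->
    nabla p X (fun q => J q (Y q)) = J p (nabla p X Y) }.

(** * Submanifolds *)

Definition tangent_map (R : realType) (m n : nat) (M : manifold R m)
    (N : manifold R n) (iota : N -> M) (p : N) (X : 'rV[R]_n) : 'rV[R]_m :=
  dir_deriv p X (phi (iota p) \o iota).

Record is_immersion (R : realType) (m n : nat) (M : manifold R m)
    (N : manifold R n) (iota : N -> M) : Prop := IsImmersion {
  imm_continuous : continuous iota;
  imm_smooth : forall p, smooth_near p (phi (iota p) \o iota);
  imm_injective : forall p, injective (tangent_map iota p) }.

Definition induced_metric (R : realType) (m n : nat) (M : manifold R m)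
    (N : manifold R n) (iota : N -> M) (g : M -> 'rV[R]_m -> 'rV[R]_m -> R) :
    N -> 'rV[R]_n -> 'rV[R]_n -> R :=
  fun p X Y => g (iota p) (tangent_map iota p X) (tangent_map iota p Y).

Definition is_normal (R : realType) (m n : nat) (M : manifold R m)
    (N : manifold R n) (iota : N -> M) (g : M -> 'rV[R]_m -> 'rV[R]_m -> R)
    (p : N) (w : 'rV[R]_m) : Prop :=
  forall X : 'rV[R]_n, g (iota p) w (tangent_map iota p X) = 0.

(* tangential part of a vector w of M at iota p, as a vector tangent to N *)
Definition tan_part (R : realType) (m n : nat) (M : manifold R m)
    (N : manifold R n) (iota : N -> M) (g : M -> 'rV[R]_m -> 'rV[R]_m -> R)
    (p : N) (w : 'rV[R]_m) : 'rV[R]_n :=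
  xget 0 [set X | is_normal iota g p (w - tangent_map iota p X)].

Definition nor_part (R : realType) (m n : nat) (M : manifold R m)
    (N : manifold R n) (iota : N -> M) (g : M -> 'rV[R]_m -> 'rV[R]_m -> R)
    (p : N) (w : 'rV[R]_m) : 'rV[R]_m :=
  w - tangent_map iota p (tan_part iota g p w).

(* The connection [nabla] of M, applied to a field V : N -> 'rV[R]_m of vectors
   of M along N (V q is tangent to M at iota q), in the direction of X tangent
   to N at p.  In the coordinate frame d_k of M around iota p, it is
   \sum_k (X(V^k) d_k + V^k nabla_X d_k), and d_k at iota p is the k-th basis
   vector of 'rV[R]_m. *)
Definition conn_along (R : realType) (m n : nat) (M : manifold R m)
    (N : manifold R n) (iota : N -> M)
    (nabla : M -> 'rV[R]_m -> (M -> 'rV[R]_m) -> 'rV[R]_m)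
    (p : N) (X : 'rV[R]_n) (V : N -> 'rV[R]_m) : 'rV[R]_m :=
  dir_deriv p X (fun q => components (iota p) (iota q) (V q))
  + \sum_(k < m) V p ord0 k *:
      nabla (iota p) (tangent_map iota p X)
            (coord_field (iota p) (delta_mx ord0 k)).

(* h(X, Y): normal part of the derivative along X of any smooth vector field
   tangent to N extending Y *)
Definition second_fundamental_form (R : realType) (m n : nat)
    (M : manifold R m) (N : manifold R n) (iota : N -> M)
    (g : M -> 'rV[R]_m -> 'rV[R]_m -> R)
    (nabla : M -> 'rV[R]_m -> (M -> 'rV[R]_m) -> 'rV[R]_m)
    (p : N) (X Y : 'rV[R]_n) : 'rV[R]_m :=
  xget 0 [set w | forall Z : N -> 'rV[R]_n,
    smooth_field_near p Z -> Z p = Y ->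
    w = nor_part iota g p
          (conn_along iota nabla p X (fun q => tangent_map iota q (Z q)))].

(* A_xi X, for xi normal to N at p *)
Definition weingarten (R : realType) (m n : nat)
    (M : manifold R m) (N : manifold R n) (iota : N -> M)
    (g : M -> 'rV[R]_m -> 'rV[R]_m -> R)
    (nabla : M -> 'rV[R]_m -> (M -> 'rV[R]_m) -> 'rV[R]_m)
    (p : N) (xi : 'rV[R]_m) (X : 'rV[R]_n) : 'rV[R]_n :=
  xget 0 [set Z | forall Y : 'rV[R]_n,
    induced_metric iota g p Z Y
    = g (iota p) (second_fundamental_form iota g nabla p X Y) xi].

Definition normal_connection (R : realType) (m n : nat)
    (M : manifold R m) (N : manifold R n) (iota : N -> M)
    (g : M -> 'rV[R]_m -> 'rV[R]_m -> R)
    (nabla : M -> 'rV[R]_m -> (M -> 'rV[R]_m) -> 'rV[R]_m)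
    (p : N) (X : 'rV[R]_n) (xi : N -> 'rV[R]_m) : 'rV[R]_m :=
  nor_part iota g p (conn_along iota nabla p X xi).

Definition P_op (R : realType) (m n : nat) (M : manifold R m)
    (N : manifold R n) (iota : N -> M) (g : M -> 'rV[R]_m -> 'rV[R]_m -> R)
    (J : M -> 'rV[R]_m -> 'rV[R]_m) (p : N) (X : 'rV[R]_n) : 'rV[R]_n :=
  tan_part iota g p (J (iota p) (tangent_map iota p X)).

Definition F_op (R : realType) (m n : nat) (M : manifold R m)
    (N : manifold R n) (iota : N -> M) (g : M -> 'rV[R]_m -> 'rV[R]_m -> R)
    (J : M -> 'rV[R]_m -> 'rV[R]_m) (p : N) (X : 'rV[R]_n) : 'rV[R]_m :=
  nor_part iota g p (J (iota p) (tangent_map iota p X)).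

Definition t_op (R : realType) (m n : nat) (M : manifold R m)
    (N : manifold R n) (iota : N -> M) (g : M -> 'rV[R]_m -> 'rV[R]_m -> R)
    (J : M -> 'rV[R]_m -> 'rV[R]_m) (p : N) (xi : 'rV[R]_m) : 'rV[R]_n :=
  tan_part iota g p (J (iota p) xi).

Definition f_op (R : realType) (m n : nat) (M : manifold R m)
    (N : manifold R n) (iota : N -> M) (g : M -> 'rV[R]_m -> 'rV[R]_m -> R)
    (J : M -> 'rV[R]_m -> 'rV[R]_m) (p : N) (xi : 'rV[R]_m) : 'rV[R]_m :=
  nor_part iota g p (J (iota p) xi).

(* (nabla_X P) Y at p, for a vector field Y tangent to N; [nablaN] is the
   connection of N *)
Definition nabla_P (R : realType) (m n : nat) (M : manifold R m)
    (N : manifold R n) (iota : N -> M) (g : M -> 'rV[R]_m -> 'rV[R]_m -> R)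
    (J : M -> 'rV[R]_m -> 'rV[R]_m)
    (nablaN : N -> 'rV[R]_n -> (N -> 'rV[R]_n) -> 'rV[R]_n)
    (p : N) (X : 'rV[R]_n) (Y : N -> 'rV[R]_n) : 'rV[R]_n :=
  nablaN p X (fun q => P_op iota g J q (Y q))
  - P_op iota g J p (nablaN p X Y).

(* (nabla_X F) Y at p *)
Definition nabla_F (R : realType) (m n : nat) (M : manifold R m)
    (N : manifold R n) (iota : N -> M) (g : M -> 'rV[R]_m -> 'rV[R]_m -> R)
    (J : M -> 'rV[R]_m -> 'rV[R]_m)
    (nablaM : M -> 'rV[R]_m -> (M -> 'rV[R]_m) -> 'rV[R]_m)
    (nablaN : N -> 'rV[R]_n -> (N -> 'rV[R]_n) -> 'rV[R]_n)
    (p : N) (X : 'rV[R]_n) (Y : N -> 'rV[R]_n) : 'rV[R]_m :=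
  normal_connection iota g nablaM p X (fun q => F_op iota g J q (Y q))
  - F_op iota g J p (nablaN p X Y).

(* Main.v *)
Require Import Defs.
From HB Require Import structures.
From mathcomp Require Import all_boot all_order all_algebra.
From mathcomp Require Import all_classical all_reals all_analysis lra.

Set Implicit Arguments.
Unset Strict Implicit.
Unset Printing Implicit Defensive.

Import Order.TTheory GRing.Theory Num.Theory numFieldNormedType.Exports.
Local Open Scope classical_set_scope.
Local Open Scope ring_scope.

(** Write D for the connection of M along N and T for the differential of the
immersion. Expanding fields along N in a coordinate frame of M shows that D is
compatible with g and commutes with J. The tangential part of D_X (T Y) is
torsion free and metric, so it differs from nabla^N by a tensor which is
symmetric in X, Y and skew in Y, Z, hence zero: this is the Gauss formula
D_X (T Y) = T (nabla^N_X Y) + h(X, Y). Differentiating g(xi, T Y) = 0 gives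
tan (D_X xi) = - A_xi X for normal xi. Now (i) and (ii) are the tangential and
normal parts of
  J (T (nabla^N_X Y)) + J (h(X, Y)) = D_X (J T Y) = D_X (T P Y) + D_X (F Y).
For this P Y has to be a smooth field: its coordinates solve a linear system
whose matrix is the Gram matrix of the induced metric. The two equivalences
follow by pairing the formulas with vectors, since J is skew and h symmetric. *)

(** * Calculus on open sets *)

(** The maps [tan_part], [second_fundamental_form] and [weingarten] are defined by choice, with
    default 0, so each needs an existence proof before its defining property can be used. For
    [tan_part] and [weingarten] this is the Riesz representation for the induced metric. For
    [second_fundamental_form] it is independence of the extending field, which comes from the
    torsion identity. A vector at q is written in the chart at q, and these charts vary arbitrarily
    with q. The raw coordinates of a smooth field therefore need not be continuous, and smoothness
    is always tested after conversion to one fixed chart. Such conversions are valid only near the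
    base point, hence the many equalities under [near]. Uniqueness of the Levi-Civita connection is
    not invoked for the tangential part of D; that would first require all of [is_connection] for
    it. Its difference with nabla^N is shown to vanish directly on smooth fields. The conditions on
    nabla P and nabla F quantify over fields, those on A over vectors; fields with constant
    components in a chart pass from one to the other. *)

Section Differentiability.
Variables (R : realType).
Implicit Types (V W : normedModType R).

(** The difference [h = g - f] vanishes near [x], so it is differentiable there with differential 0,
    and [g = f + h]. *)
Lemma near_eq_differentiable V W (f g : V -> W) (x : V) :
  (\near x, f x = g x) -> differentiable f x -> differentiable g x.
Proof.
move=> fg df; pose h := g - f; have hE y : h y = g y - f y by [].
have h0 : continuous (0 : V -> W) /\
    h \o shift x = cst (h x) + (0 : V -> W) +o_ 0 id.
  split; first exact: cst_continuous.
  apply/eqaddoE; rewrite addr0; apply/eqaddoP => e e0.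
  have fg0 : \forall y \near 0, f (y + x) = g (y + x).
    by move: fg; rewrite (near_shift 0) /= subr0.
  near=> y.
  have hx : h x = 0 by rewrite hE (nbhs_singleton fg) subrr.
  have hy : h (y + x) = 0.
    rewrite hE; suff -> : f (y + x) = g (y + x) by rewrite subrr.
    by near: y.
  by rewrite !fctE /= hx hy subrr normr0 mulr_ge0 // ltW.
have -> : g = f + h by rewrite /h addrC subrK.
apply: differentiableD => //.
apply/diff_locallyP.
have -> : 'd h x = 0 :> (V -> W) by apply/diff_unique; case: h0.
exact: h0.
Unshelve. all: by end_near. Qed.

Lemma derive_comp V W W' (f : V -> W) (g : W -> W') (x v : V) :
  differentiable f x -> differentiable g (f x) ->
  'D_v (g \o f) x = 'D_('D_v f x) g (f x).
Proof.
move=> df dg; rewrite !deriveE //; last exact: differentiable_comp.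
by rewrite diff_comp.
Qed.

End Differentiability.

(** * Linear maps, with linearity as a hypothesis: [components p q] is known to be linear only for
    [q] in the chart domain *)

Section LinearFunctions.
Variables (R : pzRingType) (V W : lmodType R) (f : V -> W).
Hypothesis linf : linear f.

Lemma linear_funD u v : f (u + v) = f u + f v.
Proof. by rewrite -[u in LHS]scale1r linf scale1r. Qed.

Lemma linear_fun0 : f 0 = 0.
Proof. by apply: (addrI (f 0)); rewrite -linear_funD !addr0. Qed.

Lemma linear_funZ a u : f (a *: u) = a *: f u.
Proof. by rewrite -[a *: u]addr0 linf linear_fun0 addr0. Qed.

Lemma linear_funN u : f (- u) = - f u.
Proof. by rewrite -!scaleN1r linear_funZ. Qed.

Lemma linear_funB u v : f (u - v) = f u - f v.
Proof. by rewrite linear_funD linear_funN. Qed.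

Lemma linear_fun_sum I (r : seq I) (a : I -> R) (e : I -> V) :
  f (\sum_(i <- r) a i *: e i) = \sum_(i <- r) a i *: f (e i).
Proof.
elim: r => [|i r IH]; first by rewrite !big_nil linear_fun0.
by rewrite !big_cons linf IH.
Qed.

End LinearFunctions.

Section LinearMaps.
Variables (R : realType).
Implicit Types (V W : normedModType R).

Lemma differentiable_linear W W' (L : W -> W') (x : W) :
  linear L -> continuous L -> differentiable L x.
Proof.
move=> linL ctsL; pose LM := GRing.isLinear.Build _ _ _ _ L linL.
pose LL : {linear W -> W'} := HB.pack L LM.
exact: (@linear_differentiable _ _ _ LL).
Qed.

Lemma derive_linear W W' (L : W -> W') (x v : W) :
  linear L -> continuous L -> 'D_v L x = L v.
Proof.
move=> linL ctsL; rewrite deriveE; last exact: differentiable_linear.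
pose LM := GRing.isLinear.Build _ _ _ _ L linL.
pose LL : {linear W -> W'} := HB.pack L LM.
by rewrite (@diff_lin _ _ _ LL).
Qed.

Lemma linear_coord m n (i : 'I_m) (j : 'I_n) :
  linear (fun A : 'M[R]_(m, n) => A i j : R^o).
Proof. by move=> a u v; rewrite !mxE. Qed.

Lemma continuous_coord m n (i : 'I_m) (j : 'I_n) :
  continuous (fun A : 'M[R]_(m, n) => A i j : R^o).
Proof. exact: coord_continuous. Qed.

Lemma linear_scalel W (w : W) : linear (fun a : R^o => (a : R) *: w).
Proof. by move=> a u v; rewrite scalerDl scalerA. Qed.

Lemma continuous_scalel W (w : W) : continuous (fun a : R^o => (a : R) *: w).
Proof. exact: scalel_continuous. Qed.

Lemma derive_dirD V W (f : V -> W) x a u v : differentiable f x ->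
  'D_(a *: u + v) f x = a *: 'D_u f x + 'D_v f x.
Proof. by move=> df; rewrite !deriveE // linearP. Qed.

Lemma derive_dir_sum V W (f : V -> W) x I (r : seq I) (a : I -> R) (e : I -> V) :
  differentiable f x ->
  'D_(\sum_(i <- r) a i *: e i) f x = \sum_(i <- r) a i *: 'D_(e i) f x.
Proof.
move=> df; rewrite deriveE // linear_sum; apply: eq_bigr => i _.
by rewrite linearZ deriveE.
Qed.

End LinearMaps.

(** * Closure properties of functions of class C^k on an open set *)

Section SmoothOn.
Variables (R : realType).
Implicit Types (V W : normedModType R).

(** Openness turns equality on [U] into equality near each point of [U], so that all directional
    derivatives agree on [U] as well and the induction goes through. *)
Lemma Ck_on_ext V W k (U : set V) (f g : V -> W) : open U ->
  (forall x, U x -> f x = g x) -> Ck_on k U f -> Ck_on k U g.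
Proof.
move=> oU; elim: k f g => [|k IH] f g fg /=.
  move=> cf x Ux; have fgx : \near x, f x = g x.
    by apply: filterS (open_nbhs_nbhs (conj oU Ux)).
  rewrite /prop_for /continuous_at -fg //.
  by apply: cvg_trans (cf x Ux); apply: near_eq_cvg.
move=> [df Df]; have fgn x : U x -> \near x, f x = g x.
  by move=> Ux; apply: filterS (open_nbhs_nbhs (conj oU Ux)).
split=> [x Ux|v]; first exact: near_eq_differentiable (fgn x Ux) (df x Ux).
by apply: IH (Df v) => x Ux; apply: near_eq_derive; exact: fgn.
Qed.

Lemma Ck_on_sub V W k (U U' : set V) (f : V -> W) :
  U' `<=` U -> Ck_on k U f -> Ck_on k U' f.
Proof.
move=> UU'; elim: k f => [|k IH] f /=; first by move=> cf x /UU'/cf.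
by move=> [df Df]; split=> [x /UU'/df //|v]; exact: IH.
Qed.

Lemma Ck_onS V W k (U : set V) (f : V -> W) : Ck_on k.+1 U f -> Ck_on k U f.
Proof.
elim: k f => [|k IH] f; first by case=> df _ x /df/differentiable_continuous.
by case=> df Df; split=> // v; apply: IH; exact: Df.
Qed.

Lemma Ck_on_cst V W k (U : set V) (w : W) : Ck_on k U (fun=> w).
Proof.
elim: k w => [|k IH] w; first by move=> x _; exact: cst_continuous.
split=> [x _|v]; first exact: differentiable_cst.
under eq_fun do rewrite derive_cst.
exact: IH.
Qed.

Lemma Ck_on_linear V W W' (L : W -> W') k (U : set V) (f : V -> W) :
  linear L -> continuous L -> open U -> Ck_on k U f -> Ck_on k U (L \o f).
Proof.
move=> linL ctsL oU; elim: k f => [|k IH] f /=.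
  by move=> cf x Ux; apply: continuous_comp; [exact: cf|exact: ctsL].
move=> [df Df]; split=> [x Ux|v].
  by apply: differentiable_comp; [exact: df|exact: differentiable_linear].
apply: Ck_on_ext (IH _ (Df v)) => // x Ux /=.
rewrite derive_comp; [|exact: df|exact: differentiable_linear].
by rewrite (derive_linear _ _ linL ctsL).
Qed.

Lemma Ck_on_add V W k (U : set V) (f g : V -> W) : open U ->
  Ck_on k U f -> Ck_on k U g -> Ck_on k U (fun x => f x + g x).
Proof.
move=> oU; elim: k f g => [|k IH] f g /=.
  by move=> cf cg x Ux; apply: cvgD; [exact: cf|exact: cg].
move=> [df Df] [dg Dg]; split=> [x Ux|v].
  by apply: differentiableD; [exact: df|exact: dg].
apply: Ck_on_ext (IH _ _ (Df v) (Dg v)) => // x Ux /=.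
by rewrite -deriveD //; apply: diff_derivable; [exact: df|exact: dg].
Qed.

Lemma Ck_on_sum V W k (U : set V) I (r : seq I) (P : pred I) (f : I -> V -> W) :
  open U -> (forall i, P i -> Ck_on k U (f i)) ->
  Ck_on k U (fun x => \sum_(i <- r | P i) f i x).
Proof.
move=> oU Cf; elim: r => [|i r IH].
  rewrite (_ : (fun x => _) = fun=> 0); first exact: Ck_on_cst.
  by apply/funext => x; rewrite big_nil.
rewrite (_ : (fun x => _) = fun x => if P i then f i x + \sum_(j <- r | P j) f j x
  else \sum_(j <- r | P j) f j x); last by apply/funext => x; rewrite big_cons.
by case Pi: (P i) => //; apply: Ck_on_add => //; exact: Cf.
Qed.

Lemma Ck_on_mul V k (U : set V) (f g : V -> R^o) : open U ->
  Ck_on k U f -> Ck_on k U g -> Ck_on k U (fun x => (f x : R) * g x : R^o).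
Proof.
move=> oU; elim: k f g => [|k IH] f g.
  by move=> cf cg x Ux; apply: cvgM; [exact: cf|exact: cg].
move=> Cf Cg; case: (Cf) (Cg) => df Df [dg Dg]; split=> [x Ux|v].
  by apply: differentiableM; [exact: df|exact: dg].
have Cf' := Ck_onS Cf; have Cg' := Ck_onS Cg.
apply: Ck_on_ext (Ck_on_add oU (IH _ _ Cf' (Dg v)) (IH _ _ Cg' (Df v))) => //.
move=> x Ux; symmetry; apply: (@deriveM _ _ f g x v); apply: diff_derivable.
  exact: df.
exact: dg.
Qed.

Lemma Ck_on_inv V k (U : set V) (f : V -> R^o) : open U ->
  (forall x, U x -> f x != 0) ->
  Ck_on k U f -> Ck_on k U (fun x => (f x : R)^-1 : R^o).
Proof.
move=> oU f0; elim: k => [|k IH].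
  by move=> cf x Ux; apply: cvgV; [exact: f0|exact: cf].
move=> Cf; case: (Cf) => df Df; split=> [x Ux|v].
  by apply: differentiableV; [exact: df|exact: f0].
(* The derivative of [1/f] is [-(1/f)^2] times that of [f], so it has class [k] as soon as [1/f] has
   class [k]. *)
have Ci := IH (Ck_onS Cf).
apply: Ck_on_ext (Ck_on_mul oU (Ck_on_cst k U (-1 : R^o))
  (Ck_on_mul oU (Ck_on_mul oU Ci Ci) (Df v))) => // x Ux /=.
rewrite deriveV; [|exact: f0|by apply: diff_derivable; exact: df].
by rewrite /GRing.scale /= -expr2 exprVn mulN1r mulNr.
Qed.

Lemma Ck_on_coord V k (U : set V) m n (f : V -> 'M[R]_(m, n)) i j : open U ->
  Ck_on k U f -> Ck_on k U (fun x => f x i j : R^o).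
Proof.
exact: (Ck_on_linear (@linear_coord _ _ _ _ _) (@continuous_coord _ _ _ _ _)).
Qed.

(** The derivative of [f \o G] along [v] is the sum over [i] of the [i]-th coordinate of ['D_v G]
    times the [i]-th partial derivative of [f] composed with [G]. The induction hypothesis applies
    to these partial derivatives. Scalar values of [f] make each term an ordinary product. *)
Lemma Ck_on_comp V m k (U : set V) (U' : set 'rV[R]_m) (G : V -> 'rV[R]_m)
    (f : 'rV[R]_m -> R^o) : open U -> (forall x, U x -> U' (G x)) ->
  Ck_on k U G -> Ck_on k U' f -> Ck_on k U (f \o G).
Proof.
move=> oU UU'; elim: k G f UU' => [|k IH] G f UU'.
  by move=> cG cf x Ux; apply: continuous_comp; [exact: cG|apply: cf; exact: UU'].
move=> CG [df Df]; case: (CG) => dG DG; split=> [x Ux|v].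
  by apply: differentiable_comp; [exact: dG|apply: df; exact: UU'].
apply: (@Ck_on_ext _ _ _ _ (fun x => \sum_(i < m) ('D_v G x ord0 i) *
    ('D_(delta_mx ord0 i) f \o G) x : R^o)) => //.
  move=> x Ux; rewrite (@derive_comp _ _ _ _ G f);
    [|exact: dG|by apply: df; exact: UU'].
  rewrite [in RHS](row_sum_delta ('D_v G x)) derive_dir_sum //.
  by apply: df; exact: UU'.
apply: Ck_on_sum => // i _; apply: Ck_on_mul => //.
  by apply: Ck_on_coord => //; exact: DG.
by apply: IH => //; [exact: Ck_onS CG|exact: Df].
Qed.

End SmoothOn.

(** * Charts and smooth functions *)

Section Charts.
Variables (R : realType) (m : nat) (M : manifold R m).
Implicit Types (W : normedModType R) (p q r : M) (u v w : 'rV[R]_m).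

Definition domain p : set M := chart_dom (chart_at p).

Lemma domain_self p : domain p p.
Proof. exact: chart_at_dom. Qed.

Lemma phiK p q : domain p q -> psi p (phi p q) = q.
Proof. exact: chart_mapK. Qed.

Lemma near_domain p q : domain p q -> \forall q' \near q, domain p q'.
Proof.
move=> pq; apply: open_nbhs_nbhs; split=> //; exact: chart_dom_open.
Qed.

Lemma near_psi p q (P : set M) : domain p q ->
  (\forall q' \near q, P q') -> \forall x \near phi p q, P (psi p x).
Proof.
move=> pq Pq.
have im_q : (chart_map (chart_at p) @` domain p) (phi p q) by exists q.
by have := chart_inv_cont im_q; apply; rewrite -/(psi p _) phiK.
Qed.

Lemma near_phi p q (P : set 'rV[R]_m) : domain p q ->
  (\forall x \near phi p q, P x) -> \forall q' \near q, P (phi p q').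
Proof. by move=> pq; exact: (chart_map_cont pq). Qed.

Lemma near_psiK p q : domain p q -> \forall x \near phi p q,
  domain p (psi p x) /\ phi p (psi p x) = x.
Proof.
move=> pq; apply: (@filterS _ _ _ (chart_map (chart_at p) @` domain p)).
  by move=> _ [q' pq' <-]; rewrite -/(phi p q') phiK.
apply: open_nbhs_nbhs; split; first exact: chart_im_open.
by exists q.
Qed.

Lemma differentiable_transition p q r : domain p q -> domain r q ->
  differentiable (phi r \o psi p) (phi p q).
Proof.
move=> pq rq; have [dif _] := chart_at_compat p r 1%N.
by apply: dif; exists q.
Qed.

Lemma near_change_chart W p q r (f : M -> W) : domain p q -> domain r q ->
  \forall x \near phi p q,
    ((f \o psi r) \o (phi r \o psi p)) x = (f \o psi p) x.
Proof.
move=> pq rq; apply: filterS (near_psi pq (near_domain rq)) => x rx /=.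
by rewrite phiK.
Qed.

Lemma change_chart_phi p q r : domain p q -> (phi r \o psi p) (phi p q) = phi r q.
Proof. by move=> pq /=; rewrite phiK. Qed.

Lemma differentiable_change_chart W p q r (f : M -> W) :
  domain p q -> domain r q -> differentiable (f \o psi r) (phi r q) ->
  differentiable (f \o psi p) (phi p q).
Proof.
move=> pq rq df; apply: near_eq_differentiable (near_change_chart f pq rq) _.
apply: differentiable_comp; first exact: differentiable_transition.
by rewrite change_chart_phi.
Qed.

(** Chain rule for the transition map: passing from the chart at [p] to the chart at [r] transforms
    the direction by the Jacobian. All conversions between [components], [coord_field] and
    [dir_deriv] are instances of it. *)
Lemma derive_change_chart W p q r (f : M -> W) w :
  domain p q -> domain r q -> differentiable (f \o psi r) (phi r q) ->
  'D_w (f \o psi p) (phi p q) =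
  'D_('D_w (phi r \o psi p) (phi p q)) (f \o psi r) (phi r q).
Proof.
move=> pq rq df; rewrite -(near_eq_derive _ (near_change_chart f pq rq)).
rewrite derive_comp ?change_chart_phi //.
exact: differentiable_transition.
Qed.

Lemma derive_phi_psi p q w : domain p q -> 'D_w (phi p \o psi p) (phi p q) = w.
Proof.
move=> pq; rewrite -[RHS](derive_id (phi p q)); apply: near_eq_derive.
by apply: filterS (near_psiK pq) => x [].
Qed.

Lemma components_self p w : components p p w = w.
Proof. exact: derive_phi_psi (domain_self p). Qed.

Lemma components_linear p q : domain p q -> linear (components p q).
Proof.
move=> pq a u v; apply: derive_dirD.
by apply: differentiable_transition => //; exact: domain_self.
Qed.

Lemma dir_deriv_components W p q (f : M -> W) w : domain p q ->
  differentiable (f \o psi p) (phi p q) ->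
  dir_deriv q w f = 'D_(components p q w) (f \o psi p) (phi p q).
Proof. by move=> pq df; apply: derive_change_chart => //; exact: domain_self. Qed.

Lemma coord_field_linear p q : domain p q -> linear (coord_field p ^~ q).
Proof.
move=> pq a u v; apply: derive_dirD.
by apply: differentiable_transition => //; exact: domain_self.
Qed.

(** At [q], [coord_field p] and [components p q] are the Jacobians of two mutually inverse
    transition maps, between the charts at [p] and at [q]. *)
Lemma coord_fieldK p q w : domain p q -> components p q (coord_field p w q) = w.
Proof.
move=> pq; rewrite -[RHS](derive_phi_psi w pq).
symmetry; apply: derive_change_chart => //; first exact: domain_self.
by apply: differentiable_transition => //; exact: domain_self.
Qed.

Lemma componentsK p q w : domain p q -> coord_field p (components p q w) q = w.
Proof.
move=> pq; rewrite -[RHS](components_self q w); symmetry.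
apply: dir_deriv_components => //.
by apply: differentiable_transition => //; exact: domain_self.
Qed.

Lemma coord_field_self p w : coord_field p w p = w.
Proof. exact: derive_phi_psi (domain_self p). Qed.

Lemma coord_field_expand p q w : domain p q ->
  w = \sum_k components p q w ord0 k *: coord_field p (delta_mx ord0 k) q.
Proof.
move=> pq; rewrite -[LHS](componentsK w pq) [in LHS](row_sum_delta (components p q w)).
exact: (linear_fun_sum (coord_field_linear pq)).
Qed.

End Charts.

(** * Smooth functions and fields near a point of a manifold *)

Section SmoothNear.
Variables (R : realType) (m : nat) (M : manifold R m).
Implicit Types (W : normedModType R) (p q r : M) (u v w : 'rV[R]_m).

Lemma smooth_near_differentiable_near W p (f : M -> W) : smooth_near p f ->
  \forall q \near p, differentiable (f \o psi p) (phi p q).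
Proof.
move=> [U [oU Up /(_ 1%N) [df _]]].
apply: (near_phi (P := fun x => differentiable (f \o psi p) x) (domain_self p)).
by apply: filterS (open_nbhs_nbhs (conj oU Up)).
Qed.

Lemma smooth_near_differentiable W p (f : M -> W) : smooth_near p f ->
  differentiable (f \o psi p) (phi p p).
Proof. by move=> /smooth_near_differentiable_near /nbhs_singleton. Qed.

(** Since [dir_deriv q] reads [f] in the chart at [q], iterated derivatives require
    differentiability in these moving charts and not only in the chart at [p]. *)
Lemma near_smooth_differentiable W p (f : M -> W) : smooth_near p f ->
  \forall q \near p, differentiable (f \o psi q) (phi q q).
Proof.
move=> /smooth_near_differentiable_near df.
apply: filterS2 (near_domain (domain_self p)) df => q pq.
by apply: differentiable_change_chart => //; exact: domain_self.
Qed.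

Lemma smooth_near1 W W' p (f : M -> W) (g : M -> W') :
  (forall U, open U -> U (phi p p) -> smooth_on U (f \o psi p) ->
     smooth_on U (g \o psi p)) ->
  smooth_near p f -> smooth_near p g.
Proof. by move=> H [U [oU Up fU]]; exists U; split=> //; exact: H. Qed.

Lemma smooth_near2 W W' W'' p (f : M -> W) (g : M -> W') (h : M -> W'') :
  (forall U, open U -> U (phi p p) -> smooth_on U (f \o psi p) ->
     smooth_on U (g \o psi p) -> smooth_on U (h \o psi p)) ->
  smooth_near p f -> smooth_near p g -> smooth_near p h.
Proof.
move=> H [U [oU Up fU]] [U' [oU' Up' fU']].
exists (U `&` U'); split=> //; first exact: openI.
apply: H => //; first exact: openI.
- by move=> k; apply: Ck_on_sub (fU k) => x [].
- by move=> k; apply: Ck_on_sub (fU' k) => x [].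
Qed.

Lemma smooth_near_restrict W p (f : M -> W) (P : set 'rV[R]_m) :
  (\forall x \near phi p p, P x) -> smooth_near p f ->
  exists U, [/\ open U, U (phi p p), U `<=` P & smooth_on U (f \o psi p)].
Proof.
rewrite -[X in X -> _]/(nbhs _ P) nbhsE => -[U' [oU' U'p] U'P] [U [oU Up fU]].
exists (U `&` U'); split=> //; first exact: openI.
  by move=> x [_ /U'P].
by move=> k; apply: Ck_on_sub (fU k) => x [].
Qed.

Lemma smooth_near_ext W p (f g : M -> W) :
  (\forall q \near p, f q = g q) -> smooth_near p f -> smooth_near p g.
Proof.
move=> /(near_psi (domain_self p)) fg sf.
have [U [oU Up Ufg fU]] := smooth_near_restrict fg sf.
by exists U; split=> // k; apply: Ck_on_ext (fU k).
Qed.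

Lemma smooth_near_cst W p (w : W) : smooth_near p (fun=> w).
Proof.
exists setT; split=> [||k]; [exact: openT|by []|exact: (Ck_on_cst k setT w)].
Qed.

Lemma smooth_near_add W p (f g : M -> W) :
  smooth_near p f -> smooth_near p g -> smooth_near p (fun q => f q + g q).
Proof.
by apply: smooth_near2 => U oU _ sf sg k; apply: Ck_on_add (sf k) (sg k).
Qed.

Lemma smooth_near_sum W p I (s : seq I) (P : pred I) (f : I -> M -> W) :
  (forall i, P i -> smooth_near p (f i)) ->
  smooth_near p (fun q => \sum_(i <- s | P i) f i q).
Proof.
move=> sf; elim: s => [|i s IH].
  apply: smooth_near_ext (smooth_near_cst p 0).
  by apply: nearW => q; rewrite big_nil.
case Pi: (P i).
  apply: smooth_near_ext (smooth_near_add (sf i Pi) IH).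
  by apply: nearW => q; rewrite big_cons Pi.
by apply: smooth_near_ext IH; apply: nearW => q; rewrite big_cons Pi.
Qed.

Lemma smooth_near_mul p (f g : M -> R^o) : smooth_near p f -> smooth_near p g ->
  smooth_near p (fun q => (f q : R) * g q : R^o).
Proof.
by apply: smooth_near2 => U oU _ sf sg k; apply: Ck_on_mul (sf k) (sg k).
Qed.

Lemma smooth_near_prod p I (s : seq I) (f : I -> M -> R^o) :
  (forall i, smooth_near p (f i)) ->
  smooth_near p (fun q => \prod_(i <- s) (f i q : R) : R^o).
Proof.
move=> sf; elim: s => [|i s IH].
  apply: smooth_near_ext (smooth_near_cst p (1 : R^o)).
  by apply: nearW => q; rewrite big_nil.
apply: smooth_near_ext (smooth_near_mul (sf i) IH).
by apply: nearW => q; rewrite big_cons.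
Qed.

Lemma smooth_near_inv p (f : M -> R^o) :
  (\forall q \near p, f q != 0) -> smooth_near p f ->
  smooth_near p (fun q => (f q : R)^-1 : R^o).
Proof.
move=> /(near_psi (domain_self p)) f0 sf.
have [U [oU Up Uf fU]] := smooth_near_restrict f0 sf.
by exists U; split=> // k; apply: Ck_on_inv (fU k).
Qed.

Lemma smooth_near_linear W W' p (L : W -> W') (f : M -> W) :
  linear L -> continuous L -> smooth_near p f -> smooth_near p (L \o f).
Proof.
move=> linL ctsL; apply: smooth_near1 => U oU _ sf k.
exact: Ck_on_linear (sf k).
Qed.

Lemma smooth_near_coord p k l (f : M -> 'M[R]_(k, l)) i j :
  smooth_near p f -> smooth_near p (fun q => f q i j : R^o).
Proof.
exact: (smooth_near_linear (@linear_coord _ _ _ _ _) (@continuous_coord _ _ _ _ _)).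
Qed.

Lemma smooth_near_mx p k l (f : M -> 'M[R]_(k, l)) :
  (forall i j, smooth_near p (fun q => f q i j : R^o)) -> smooth_near p f.
Proof.
move=> sf; apply: smooth_near_ext (smooth_near_sum (index_enum _)
  (P := xpredT) (f := fun i q => \sum_j f q i j *: delta_mx i j) _).
  by apply: nearW => q; rewrite -matrix_sum_delta.
move=> i _; apply: smooth_near_sum => j _.
exact: (smooth_near_linear (@linear_scalel _ _ _) (@continuous_scalel _ _ _) (sf i j)).
Qed.

Lemma smooth_near_scale p k l (a : M -> R^o) (f : M -> 'M[R]_(k, l)) :
  smooth_near p a -> smooth_near p f ->
  smooth_near p (fun q => (a q : R) *: f q).
Proof.
move=> sa sf; apply: smooth_near_mx => i j.
apply: smooth_near_ext (smooth_near_mul sa (smooth_near_coord i j sf)).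
by apply: nearW => q; rewrite mxE.
Qed.

Lemma smooth_near_phi p : smooth_near p (phi p).
Proof.
(* A constant function is restricted in order to extract an open set around [phi p p] on which
   [phi p \o psi p] is the identity. *)
have [U [oU Up UP _]] := smooth_near_restrict (near_psiK (domain_self p))
  (smooth_near_cst p (0 : R^o)).
exists U; split=> //; case=> [|k].
  move=> x Ux; apply: differentiable_continuous.
  have [px xE] := UP _ Ux; rewrite -xE.
  exact: differentiable_transition.
split=> [x Ux|v].
  have [px xE] := UP _ Ux; rewrite -xE.
  exact: differentiable_transition.
apply: Ck_on_ext (Ck_on_cst k U v) => // x Ux.
have [px xE] := UP _ Ux; rewrite -xE.
by rewrite derive_phi_psi.
Qed.

Lemma smooth_field_near_coord p w : smooth_field_near p (coord_field p w).
Proof.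
apply: smooth_near_ext (smooth_near_cst p w).
by apply: filterS (near_domain (domain_self p)) => q pq; rewrite coord_fieldK.
Qed.

(** In the fixed chart at [p] the derivative is a sum of components of [Y] times partial derivatives
    of [f], and both kinds of factors are smooth there. *)
Lemma smooth_near_dir_deriv p k (Y : M -> 'rV[R]_m) (f : M -> 'rV[R]_k) :
  smooth_field_near p Y -> smooth_near p f ->
  smooth_near p (fun q => dir_deriv q (Y q) f).
Proof.
move=> sY sf.
apply: (@smooth_near_ext _ _ (fun q => \sum_i (components p q (Y q) ord0 i) *:
    'D_(delta_mx ord0 i) (f \o psi p) (phi p q))).
  apply: filterS2 (near_domain (domain_self p))
    (smooth_near_differentiable_near sf) => q pq df.
  rewrite (@dir_deriv_components _ _ _ _ p) //.
  by rewrite [in RHS](row_sum_delta (components p q (Y q))) derive_dir_sum.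
apply: smooth_near_sum => i _; apply: smooth_near_scale.
  exact: smooth_near_coord sY.
have [U [oU Up UP fU]] := smooth_near_restrict (near_psiK (domain_self p)) sf.
exists U; split=> // l.
(* Class [l.+1] of [f] gives class [l] of its partial derivative. *)
apply: Ck_on_ext ((fU l.+1).2 (delta_mx ord0 i)) => // x Ux /=.
by have [_ ->] := UP _ Ux.
Qed.

End SmoothNear.

(** * Derivatives and connections along an immersion *)

Section DirDeriv.
Variables (R : realType) (m : nat) (M : manifold R m).
Implicit Types (W : normedModType R) (p q r : M) (u v w : 'rV[R]_m).

Lemma dir_deriv_ext W p v (f g : M -> W) :
  (\forall q \near p, f q = g q) -> dir_deriv p v f = dir_deriv p v g.
Proof. by move=> fg; apply: near_eq_derive; exact: near_psi (domain_self p) fg. Qed.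

Lemma dir_deriv_cst W p v (w : W) : dir_deriv p v (fun=> w) = 0.
Proof. exact: derive_cst. Qed.

Lemma dir_deriv_linear W p (f : M -> W) : smooth_near p f ->
  linear (fun v => dir_deriv p v f).
Proof.
by move=> sf a u v; apply: derive_dirD; exact: smooth_near_differentiable.
Qed.

Lemma dir_deriv_add W p v (f g : M -> W) : smooth_near p f -> smooth_near p g ->
  dir_deriv p v (fun q => f q + g q) = dir_deriv p v f + dir_deriv p v g.
Proof.
move=> sf sg.
by apply: (deriveD (f := f \o psi p) (g := g \o psi p));
  apply: diff_derivable; exact: smooth_near_differentiable.
Qed.

Lemma dir_deriv_sum W p v I (s : seq I) (f : I -> M -> W) :
  (forall i, smooth_near p (f i)) ->
  dir_deriv p v (fun q => \sum_(i <- s) f i q) = \sum_(i <- s) dir_deriv p v (f i).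
Proof.
move=> sf; elim: s => [|i s IH].
  rewrite big_nil -[RHS](dir_deriv_cst p v (0 : W)).
  by apply: dir_deriv_ext; apply: nearW => q; rewrite big_nil.
rewrite big_cons -IH -dir_deriv_add //; last exact: smooth_near_sum.
by apply: dir_deriv_ext; apply: nearW => q; rewrite big_cons.
Qed.

Lemma dir_deriv_mul p v (f g : M -> R^o) : smooth_near p f -> smooth_near p g ->
  dir_deriv p v (fun q => (f q : R) * g q : R^o) =
  (dir_deriv p v f : R) * g p + (f p : R) * dir_deriv p v g.
Proof.
move=> sf sg; rewrite addrC /dir_deriv.
rewrite [LHS](@deriveM _ _ (f \o psi p) (g \o psi p)); try
  by apply: diff_derivable; exact: smooth_near_differentiable.
have fE (h : M -> R^o) : (h \o psi p) (phi p p) = h p.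
  by rewrite /= phiK //; exact: domain_self.
by rewrite !fE; congr (_ + _); exact: mulrC.
Qed.

Lemma dir_deriv_linear_map W W' p v (L : W -> W') (f : M -> W) :
  linear L -> continuous L -> differentiable (f \o psi p) (phi p p) ->
  dir_deriv p v (L \o f) = L (dir_deriv p v f).
Proof.
move=> linL ctsL df; rewrite /dir_deriv.
rewrite -[_ \o psi p]/(L \o (f \o psi p)) derive_comp //.
- exact: derive_linear.
- exact: differentiable_linear.
Qed.

Lemma dir_deriv_coord_differentiable p v k l (f : M -> 'M[R]_(k, l)) i j :
  differentiable (f \o psi p) (phi p p) ->
  dir_deriv p v (fun q => f q i j : R^o) = dir_deriv p v f i j.
Proof.
exact: (dir_deriv_linear_map v (@linear_coord _ _ _ _ _) (@continuous_coord _ _ _ _ _)).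
Qed.

Lemma dir_deriv_coord p v k l (f : M -> 'M[R]_(k, l)) i j : smooth_near p f ->
  dir_deriv p v (fun q => f q i j : R^o) = dir_deriv p v f i j.
Proof. by move/smooth_near_differentiable/dir_deriv_coord_differentiable. Qed.

Lemma dir_deriv_scale p v k l (a : M -> R^o) (f : M -> 'M[R]_(k, l)) :
  smooth_near p a -> smooth_near p f ->
  dir_deriv p v (fun q => (a q : R) *: f q) =
  (dir_deriv p v a : R) *: f p + (a p : R) *: dir_deriv p v f.
Proof.
move=> sa sf; apply/matrixP => i j.
rewrite -dir_deriv_coord; last exact: smooth_near_scale.
rewrite !mxE -dir_deriv_coord // -dir_deriv_mul //; last exact: smooth_near_coord.
by apply: dir_deriv_ext; apply: nearW => q; rewrite mxE.
Qed.

End DirDeriv.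

(** * The chain rule along the immersion *)

Section Pull.
Variables (R : realType) (m n : nat) (M : manifold R m) (N : manifold R n).
Variable iota : N -> M.
Hypothesis immN : is_immersion iota.
Implicit Types (W : normedModType R) (p q : N) (r : M) (X Y : 'rV[R]_n).

Lemma near_iota p (P : set M) :
  (\forall r \near iota p, P r) -> \forall q \near p, P (iota q).
Proof. exact: (imm_continuous immN). Qed.

Lemma near_domain_iota p : \forall q \near p, domain (iota p) (iota q).
Proof. by apply: near_iota; apply: near_domain; exact: domain_self. Qed.

(** In charts [f \o iota] factors through [phi (iota p) \o iota]. The factorisation holds near [p]
    only, where continuity keeps [iota] inside the chart domain at [iota p]. *)
Lemma dir_deriv_pull W p X (f : M -> W) :
  differentiable (f \o psi (iota p)) (phi (iota p) (iota p)) ->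
  dir_deriv p X (f \o iota) = dir_deriv (iota p) (tangent_map iota p X) f.
Proof.
move=> df; rewrite /tangent_map {2}/dir_deriv {2}/dir_deriv.
have E : (phi (iota p) \o iota \o psi p) (phi p p) = phi (iota p) (iota p).
  by rewrite /= phiK //; exact: domain_self.
rewrite -[X in 'D__ _ X]E -derive_comp ?E //; last first.
  by apply: smooth_near_differentiable; exact: imm_smooth.
apply: near_eq_derive.
apply: filterS (near_psi (domain_self p) (near_domain_iota p)) => x px /=.
by rewrite phiK.
Qed.

End Pull.

(* Unfolding these to limits makes failing unifications very slow. *)
Local Opaque dir_deriv coord_field.

(* This and similar identities are stated over an abstract zmodule because
rewriting them directly in ['rV[R]_m] unfolds the matrix operations. *)
Lemma congr_add (V : nmodType) (u u' v v' : V) : u = u' -> v = v' -> u + v = u' + v'.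
Proof. by move=> -> ->. Qed.

Section Connection.
Variables (R : realType) (m : nat) (M : manifold R m).
Variable nabla : M -> 'rV[R]_m -> (M -> 'rV[R]_m) -> 'rV[R]_m.
Hypothesis nabla_conn : is_connection nabla.
Implicit Types (p q r : M) (u v w : 'rV[R]_m).


Lemma smooth_field_comb p I (s : seq I) (a : I -> M -> R^o) (Z : I -> M -> 'rV[R]_m) :
  (forall i, smooth_near p (a i)) -> (forall i, smooth_field_near p (Z i)) ->
  smooth_field_near p (fun q => \sum_(i <- s) (a i q : R) *: Z i q).
Proof.
move=> sa sZ; apply: smooth_near_ext
  (smooth_near_sum s (P := xpredT) (fun i _ => smooth_near_scale (sa i) (sZ i))).
apply: filterS (near_domain (domain_self p)) => q pq.
by rewrite (linear_fun_sum (components_linear pq)).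
Qed.

Lemma conn0 p X : nabla p X (fun=> 0) = 0.
Proof.
have s0 : smooth_field_near p (fun=> 0 : 'rV[R]_m).
  apply: smooth_near_ext (smooth_near_cst p (0 : 'rV[R]_m)).
  apply: filterS (near_domain (domain_self p)) => q pq.
  by rewrite (linear_fun0 (components_linear pq)).
have := conn_add nabla_conn X s0 s0.
rewrite (_ : (fun _ => _) = fun=> 0); last by apply/funext => q; rewrite addr0.
by move/eqP; rewrite -subr_eq0 opprD addNKr oppr_eq0 => /eqP.
Qed.

Lemma conn_comb p X I (s : seq I) (a : I -> M -> R^o) (Z : I -> M -> 'rV[R]_m) :
  (forall i, smooth_near p (a i)) -> (forall i, smooth_field_near p (Z i)) ->
  nabla p X (fun q => \sum_(i <- s) (a i q : R) *: Z i q) =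
  \sum_(i <- s) ((dir_deriv p X (a i) : R) *: Z i p + (a i p : R) *: nabla p X (Z i)).
Proof.
move=> sa sZ; elim: s => [|i s IH].
  rewrite big_nil -[RHS](conn0 p X); congr nabla.
  by apply/funext => q; rewrite big_nil.
rewrite big_cons -IH -(conn_leibniz nabla_conn) // -(conn_add nabla_conn).
- by congr nabla; apply/funext => q; rewrite big_cons.
- apply: smooth_near_ext (smooth_near_scale (sa i) (sZ i)).
  apply: filterS (near_domain (domain_self p)) => q pq.
  by rewrite (linear_funZ (components_linear pq)).
- exact: smooth_field_comb.
Qed.

(** Locality replaces [Z] by its expansion in the coordinate frame, and the Leibniz rule does the
    rest. The right-hand side has the shape of the definition of [conn_along], which allows the two
    to be compared term by term. *)
Lemma conn_expand p X (Z : M -> 'rV[R]_m) : smooth_field_near p Z ->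
  nabla p X Z = dir_deriv p X (fun q => components p q (Z q)) +
    \sum_k Z p ord0 k *: nabla p X (coord_field p (delta_mx ord0 k)).
Proof.
move=> sZ; pose a k q : R^o := components p q (Z q) ord0 k.
have sa k : smooth_near p (a k) by exact: smooth_near_coord.
have ZE : \forall q \near p,
    Z q = \sum_k (a k q : R) *: coord_field p (delta_mx ord0 k) q.
  by apply: filterS (near_domain (domain_self p)) => q /coord_field_expand.
rewrite (conn_local nabla_conn X sZ ZE) conn_comb;
  [|exact: sa|by move=> k; exact: smooth_field_near_coord].
rewrite big_split /=; apply: congr_add.
  rewrite [RHS]row_sum_delta; apply: eq_bigr => k _.
  by rewrite coord_field_self dir_deriv_coord.
by apply: eq_bigr => k _; rewrite /a (components_self p (Z p)).
Qed.

End Connection.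

Section Immersion.
Variables (R : realType) (m n : nat) (M : manifold R m) (N : manifold R n).
Variable iota : N -> M.
Hypothesis immN : is_immersion iota.
Implicit Types (W : normedModType R) (p q : N) (r : M) (X Y : 'rV[R]_n).

Lemma tangent_mapE p X : tangent_map iota p X = dir_deriv p X (phi (iota p) \o iota).
Proof. by []. Qed.

Lemma components_tangent_map r p X : domain r (iota p) ->
  components r (iota p) (tangent_map iota p X) = dir_deriv p X (phi r \o iota).
Proof.
move=> rp; symmetry; apply: (dir_deriv_pull immN).
by apply: differentiable_transition => //; exact: domain_self.
Qed.

Lemma tangent_map_linear p : linear (tangent_map iota p).
Proof. by apply: dir_deriv_linear; exact: imm_smooth. Qed.

(** The point is to shrink the neighbourhood until [iota] maps it into the chart domain at [iota p]
    and, in that chart, into the open set where [f] is smooth; [Ck_on_comp] then applies to the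
    coordinate expressions. *)
Lemma smooth_near_pull p (f : M -> R^o) :
  smooth_near (iota p) f -> smooth_near p (f \o iota).
Proof.
move=> [U' [oU' Up' fU']].
have near_U' : \forall x \near phi p p, domain (iota p) (iota (psi p x)) /\
    U' (phi (iota p) (iota (psi p x))).
  have near_phi_U' : \forall q \near p, U' (phi (iota p) (iota q)).
    by apply: (near_iota immN) (near_phi (domain_self _) (open_nbhs_nbhs _)).
  by apply: near_psi (domain_self p) (filterI (near_domain_iota immN p) near_phi_U').
have [U [oU Up UU' GU]] := smooth_near_restrict near_U' (imm_smooth immN p).
exists U; split=> // k.
apply: (@Ck_on_ext _ _ _ _ _
  ((f \o psi (iota p)) \o ((phi (iota p) \o iota) \o psi p))) => //.
  by move=> x /UU' [dx _] /=; rewrite phiK.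
by apply: Ck_on_comp (GU k) (fU' k) => // x /UU' [].
Qed.

Lemma smooth_near_pull_mx p k l (f : M -> 'M[R]_(k, l)) :
  smooth_near (iota p) f -> smooth_near p (f \o iota).
Proof.
move=> sf; apply: smooth_near_mx => i j.
exact: smooth_near_pull (smooth_near_coord i j sf).
Qed.

(** [V q] is written in the chart at [iota q], so it is first converted to the single chart at
    [iota p]. *)
Definition smooth_along p (V : N -> 'rV[R]_m) : Prop :=
  smooth_near p (fun q => components (iota p) (iota q) (V q)).

Lemma smooth_along_ext p (V V' : N -> 'rV[R]_m) :
  (\forall q \near p, V q = V' q) -> smooth_along p V -> smooth_along p V'.
Proof. by move=> VV'; apply: smooth_near_ext; apply: filterS VV' => q ->. Qed.

Lemma smooth_along_tangent p (Y : N -> 'rV[R]_n) : smooth_field_near p Y ->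
  smooth_along p (fun q => tangent_map iota q (Y q)).
Proof.
move=> sY; apply: smooth_near_ext (smooth_near_dir_deriv sY (imm_smooth immN p)).
by apply: filterS (near_domain_iota immN p) => q pq; rewrite components_tangent_map.
Qed.

Lemma smooth_along_pull p (Z : M -> 'rV[R]_m) :
  smooth_field_near (iota p) Z -> smooth_along p (Z \o iota).
Proof. exact: smooth_near_pull_mx. Qed.

Lemma smooth_along_comb p I (s : seq I) (a : I -> N -> R^o) (V : I -> N -> 'rV[R]_m) :
  (forall i, smooth_near p (a i)) -> (forall i, smooth_along p (V i)) ->
  smooth_along p (fun q => \sum_(i <- s) (a i q : R) *: V i q).
Proof.
move=> sa sV; apply: smooth_near_ext
  (smooth_near_sum s (P := xpredT) (fun i _ => smooth_near_scale (sa i) (sV i))).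
apply: filterS (near_domain_iota immN p) => q pq.
by rewrite (linear_fun_sum (components_linear pq)).
Qed.

Lemma smooth_along_add p (V V' : N -> 'rV[R]_m) :
  smooth_along p V -> smooth_along p V' -> smooth_along p (fun q => V q + V' q).
Proof.
move=> sV sV'; apply: smooth_near_ext (smooth_near_add sV sV').
apply: filterS (near_domain_iota immN p) => q pq.
by rewrite (linear_funD (components_linear pq)).
Qed.

Lemma smooth_along_opp p (V : N -> 'rV[R]_m) :
  smooth_along p V -> smooth_along p (fun q => - V q).
Proof.
move=> sV; apply: smooth_near_ext (smooth_near_scale (smooth_near_cst p (-1 : R^o)) sV).
apply: filterS (near_domain_iota immN p) => q pq.
by rewrite scaleN1r (linear_funN (components_linear pq)).
Qed.

Lemma near_frame p (V : N -> 'rV[R]_m) : \forall q \near p,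
  V q = \sum_k components (iota p) (iota q) (V q) ord0 k *:
    coord_field (iota p) (delta_mx ord0 k) (iota q).
Proof. by apply: filterS (near_domain_iota immN p) => q /coord_field_expand. Qed.

Section ConnAlong.
Variable nabla : M -> 'rV[R]_m -> (M -> 'rV[R]_m) -> 'rV[R]_m.
Hypothesis nabla_conn : is_connection nabla.

Lemma conn_alongE p X (V : N -> 'rV[R]_m) : conn_along iota nabla p X V =
  dir_deriv p X (fun q => components (iota p) (iota q) (V q)) +
  \sum_k V p ord0 k *: nabla (iota p) (tangent_map iota p X)
    (coord_field (iota p) (delta_mx ord0 k)).
Proof. by []. Qed.

Lemma conn_along_ext p X (V V' : N -> 'rV[R]_m) : (\forall q \near p, V q = V' q) ->
  conn_along iota nabla p X V = conn_along iota nabla p X V'.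
Proof.
move=> VV'; rewrite /conn_along (nbhs_singleton VV'); apply: congr_add; last by [].
by apply: dir_deriv_ext; apply: filterS VV' => q ->.
Qed.

(** By [conn_expand] the connection coefficient terms coincide, and the derivatives of the
    components agree by the chain rule along [iota]. Identities for [nabla] thus transfer to
    coordinate frames along N. *)
Lemma conn_along_pull p X (Z : M -> 'rV[R]_m) : smooth_field_near (iota p) Z ->
  conn_along iota nabla p X (Z \o iota) = nabla (iota p) (tangent_map iota p X) Z.
Proof.
move=> sZ; rewrite (conn_expand nabla_conn _ sZ) /conn_along.
apply: congr_add; last by [].
rewrite -[RHS](dir_deriv_pull immN) //; exact: smooth_near_differentiable.
Qed.

Lemma conn_along_add p X (V V' : N -> 'rV[R]_m) :
  smooth_along p V -> smooth_along p V' ->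
  conn_along iota nabla p X (fun q => V q + V' q) =
  conn_along iota nabla p X V + conn_along iota nabla p X V'.
Proof.
move=> sV sV'; rewrite /conn_along addrACA; apply: congr_add.
  apply: etrans (dir_deriv_add X sV sV').
  apply: dir_deriv_ext; apply: filterS (near_domain_iota immN p) => q pq.
  by rewrite (linear_funD (components_linear pq)).
by rewrite -big_split; apply: eq_bigr => k _; rewrite mxE scalerDl.
Qed.

Lemma conn_along_scale p X (a : N -> R^o) (V : N -> 'rV[R]_m) :
  smooth_near p a -> smooth_along p V ->
  conn_along iota nabla p X (fun q => (a q : R) *: V q) =
  (dir_deriv p X a : R) *: V p + (a p : R) *: conn_along iota nabla p X V.
Proof.
move=> sa sV; rewrite /conn_along scalerDr addrA; apply: congr_add.
  rewrite -[in RHS](components_self (iota p) (V p)).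
  apply: etrans (dir_deriv_scale X sa sV).
  apply: dir_deriv_ext; apply: filterS (near_domain_iota immN p) => q pq.
  by rewrite (linear_funZ (components_linear pq)).
by rewrite scaler_sumr; apply: eq_bigr => k _; rewrite mxE scalerA.
Qed.

Lemma conn_along0 p X : conn_along iota nabla p X (fun=> 0) = 0.
Proof.
rewrite /conn_along big1 => [|k _]; last by rewrite mxE scale0r.
rewrite addr0 -[RHS](dir_deriv_cst p X (0 : 'rV[R]_m)); apply: dir_deriv_ext.
apply: filterS (near_domain_iota immN p) => q pq.
by rewrite (linear_fun0 (components_linear pq)).
Qed.

Lemma conn_along_comb p X I (s : seq I) (a : I -> N -> R^o) (V : I -> N -> 'rV[R]_m) :
  (forall i, smooth_near p (a i)) -> (forall i, smooth_along p (V i)) ->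
  conn_along iota nabla p X (fun q => \sum_(i <- s) (a i q : R) *: V i q) =
  \sum_(i <- s) ((dir_deriv p X (a i) : R) *: V i p +
    (a i p : R) *: conn_along iota nabla p X (V i)).
Proof.
move=> sa sV; elim: s => [|i s IH].
  rewrite big_nil -[RHS](conn_along0 p X).
  by apply: conn_along_ext; apply: nearW => q; rewrite big_nil.
rewrite big_cons -IH -conn_along_scale // -conn_along_add.
- by apply: conn_along_ext; apply: nearW => q; rewrite big_cons.
- apply: smooth_along_ext (smooth_along_comb [:: i] sa sV).
  by apply: nearW => q; rewrite big_seq1.
- exact: smooth_along_comb.
Qed.

Lemma conn_along_linear p (V : N -> 'rV[R]_m) : smooth_along p V ->
  linear (conn_along iota nabla p ^~ V).
Proof.
move=> sV a X Y; rewrite /conn_along (dir_deriv_linear sV) scalerDr addrACA.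
apply: congr_add; [by []|]; rewrite scaler_sumr -big_split; apply: eq_bigr => k _ /=.
rewrite tangent_map_linear (conn_linear nabla_conn);
  last exact: smooth_field_near_coord.
by rewrite scalerDr !scalerA mulrC.
Qed.

End ConnAlong.
End Immersion.

(** * Metric and complex structure along an immersion *)


Section MetricAlong.
Variables (R : realType) (m n : nat) (M : manifold R m) (N : manifold R n).
Variables (iota : N -> M) (immN : is_immersion iota).
Variables (g : M -> 'rV[R]_m -> 'rV[R]_m -> R) (riem_g : is_riemannian g).
Variable nabla : M -> 'rV[R]_m -> (M -> 'rV[R]_m) -> 'rV[R]_m.
Hypothesis lc_nabla : is_levi_civita g nabla.
Implicit Types (p q : N) (r : M) (X Y : 'rV[R]_n) (V W : N -> 'rV[R]_m).

Let nabla_conn := lc_connection lc_nabla.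

Lemma metric_linear_l r w : linear (fun u => g r u w : R^o).
Proof. by move=> a u v; rewrite (metric_linear riem_g). Qed.

Lemma metric_linear_r r w : linear (fun u => g r w u : R^o).
Proof.
by move=> a u v; rewrite !(Defs.metric_sym riem_g _ w) (metric_linear riem_g).
Qed.

(** Smoothness of the product is bundled with the derivative formula: differentiating a linear
    combination term by term needs both for every term. *)
Definition metric_rule p X V W : Prop :=
  smooth_near p (fun q => g (iota q) (V q) (W q) : R^o) /\
  dir_deriv p X (fun q => g (iota q) (V q) (W q) : R^o) =
    g (iota p) (conn_along iota nabla p X V) (W p) +
    g (iota p) (V p) (conn_along iota nabla p X W).

Lemma metric_rule_sym p X V W : metric_rule p X V W -> metric_rule p X W V.
Proof.
move=> [sVW dVW].
have gC : (fun q => g (iota q) (V q) (W q)) = fun q => g (iota q) (W q) (V q).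
  by apply/funext => q; exact: (Defs.metric_sym riem_g).
rewrite /metric_rule -gC; split=> //.
by rewrite dVW addrC; apply: congr_add; exact: (Defs.metric_sym riem_g).
Qed.

Lemma metric_rule_ext p X V V' W : (\forall q \near p, V q = V' q) ->
  metric_rule p X V W -> metric_rule p X V' W.
Proof.
move=> VV' [sVW dVW].
have gE : \forall q \near p,
    (g (iota q) (V q) (W q) : R^o) = g (iota q) (V' q) (W q).
  by apply: filterS VV' => q ->.
split; first exact: smooth_near_ext gE sVW.
rewrite -(dir_deriv_ext X gE) dVW (nbhs_singleton VV').
by rewrite (conn_along_ext iota nabla X VV').
Qed.

Lemma metric_rule_comb p X I (s : seq I) (a : I -> N -> R^o)
    (V : I -> N -> 'rV[R]_m) W :
  (forall i, smooth_near p (a i)) -> (forall i, smooth_along iota p (V i)) ->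
  (forall i, metric_rule p X (V i) W) ->
  metric_rule p X (fun q => \sum_(i <- s) (a i q : R) *: V i q) W.
Proof.
move=> sa sV rV.
pose h i q : R^o := a i q * g (iota q) (V i q) (W q).
have sh i : smooth_near p (h i) by apply: smooth_near_mul => //; case: (rV i).
have gE : \forall q \near p, \sum_(i <- s) h i q =
    (g (iota q) (\sum_(i <- s) (a i q : R) *: V i q) (W q) : R^o).
  by apply: nearW => q; rewrite (linear_fun_sum (metric_linear_l (iota q) (W q))).
split.
  by apply: smooth_near_ext gE _; exact: smooth_near_sum.
rewrite -(dir_deriv_ext X gE) (dir_deriv_sum X s sh) (conn_along_comb immN _ X s sa sV).
rewrite big_split (linear_funD (metric_linear_l _ _)).
rewrite !(linear_fun_sum (metric_linear_l _ _)).
rewrite -!big_split; apply: eq_bigr => i _ /=.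
have [sVW dVW] := rV i.
by rewrite dir_deriv_mul // dVW /GRing.scale /= mulrDr addrA.
Qed.

Lemma metric_rule_pull p X (Y Z : M -> 'rV[R]_m) :
  smooth_field_near (iota p) Y -> smooth_field_near (iota p) Z ->
  metric_rule p X (Y \o iota) (Z \o iota).
Proof.
move=> sY sZ; have sYZ := metric_smooth riem_g sY sZ.
split; first exact: (smooth_near_pull immN sYZ).
rewrite !(conn_along_pull immN nabla_conn) //=.
rewrite -(lc_metric lc_nabla _ sY sZ) -(dir_deriv_pull immN) //.
exact: smooth_near_differentiable.
Qed.

(** The rule is stable under smooth linear combinations in the first slot and under exchange of
    slots. Expanding [V], exchanging and expanding [W] leaves only pulled-back coordinate fields,
    for which it is metric compatibility on M. *)
Lemma metric_along p X V W : smooth_along iota p V -> smooth_along iota p W ->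
  metric_rule p X V W.
Proof.
have frame_rule V' W' : smooth_along iota p V' ->
    (forall w, metric_rule p X (coord_field (iota p) w \o iota) W') ->
    metric_rule p X V' W'.
  move=> sV' rW'.
  have VE : \forall q \near p, \sum_k (components (iota p) (iota q) (V' q) ord0 k) *:
      (coord_field (iota p) (delta_mx ord0 k) \o iota) q = V' q.
    by apply: filterS (near_frame immN p V') => q /esym.
  apply: metric_rule_ext VE _; apply: metric_rule_comb => k; last exact: rW'.
    exact: smooth_near_coord sV'.
  exact: (smooth_along_pull immN (smooth_field_near_coord _ _)).
move=> sV sW; apply: (frame_rule _ _ sV) => w; apply: metric_rule_sym.
apply: (frame_rule _ _ sW) => w'.
by apply: metric_rule_pull; exact: smooth_field_near_coord.
Qed.

Variables (J : M -> 'rV[R]_m -> 'rV[R]_m) (kaehlerM : is_kaehlerian g J nabla).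

Lemma near_frame_J p V : \forall q \near p,
  \sum_k components (iota p) (iota q) (V q) ord0 k *:
    J (iota q) (coord_field (iota p) (delta_mx ord0 k) (iota q)) = J (iota q) (V q).
Proof.
apply: filterS (near_frame immN p V) => q {2}->.
by rewrite (linear_fun_sum (kaehler_linear kaehlerM (iota q))).
Qed.

Lemma smooth_along_J p V : smooth_along iota p V ->
  smooth_along iota p (fun q => J (iota q) (V q)).
Proof.
move=> sV; apply: smooth_along_ext (near_frame_J p V) _.
apply: (smooth_along_comb immN) => k; first exact: smooth_near_coord sV.
exact: (smooth_along_pull immN
  (kaehler_smooth kaehlerM (smooth_field_near_coord _ _))).
Qed.

(** Both sides are expanded with the same coefficients, over the frame and over its image under [J].
    Terms differentiating a coefficient match by linearity of [J]; the others match because [J] is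
    parallel on M. *)
Lemma conn_along_J p X V : smooth_along iota p V ->
  conn_along iota nabla p X (fun q => J (iota q) (V q)) =
  J (iota p) (conn_along iota nabla p X V).
Proof.
move=> sV; rewrite -(conn_along_ext iota nabla X (near_frame_J p V)).
rewrite (conn_along_ext iota nabla X (near_frame immN p V)).
have sa k : smooth_near p (fun q => components (iota p) (iota q) (V q) ord0 k : R^o).
  exact: smooth_near_coord sV.
have sd k := smooth_field_near_coord (iota p) (delta_mx ord0 k).
rewrite (conn_along_comb immN _ X _ sa (fun k => smooth_along_pull immN (sd k))).
rewrite (conn_along_comb immN _ X _ sa
  (fun k => smooth_along_pull immN (kaehler_smooth kaehlerM (sd k)))).
rewrite !big_split (linear_funD (kaehler_linear kaehlerM _)).
rewrite !(linear_fun_sum (kaehler_linear kaehlerM _)); apply: congr_add; first by [].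
apply: eq_bigr => k _; rewrite !(conn_along_pull immN nabla_conn) //.
  by rewrite (kaehler_parallel kaehlerM).
exact: (kaehler_smooth kaehlerM (sd k)).
Qed.

End MetricAlong.

(** * Tangential and normal parts *)


Section InnerProduct.
Variables (R : realType) (n : nat) (b : 'rV[R]_n -> 'rV[R]_n -> R).
Hypothesis b_linear : forall w, linear (fun u => b u w : R^o).
Hypothesis b_sym : forall u v, b u v = b v u.
Hypothesis b_pos : forall u, u != 0 -> 0 < b u u.

Definition gram : 'M[R]_n := \matrix_(i, j) b (delta_mx ord0 i) (delta_mx ord0 j).

Lemma linear_form_expand (l : 'rV[R]_n -> R) (u : 'rV[R]_n) : linear (l : _ -> R^o) ->
  l u = \sum_i u ord0 i * l (delta_mx ord0 i).
Proof. by move=> linl; rewrite [in LHS](row_sum_delta u) (linear_fun_sum linl). Qed.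

Lemma inner_product_linear_r u : linear (b u : _ -> R^o).
Proof. by move=> a v w; rewrite !(b_sym u) b_linear. Qed.

Lemma mul_gram (c : 'rV[R]_n) j : (c *m gram) ord0 j = b c (delta_mx ord0 j).
Proof.
rewrite (linear_form_expand c (b_linear (delta_mx ord0 j))) mxE.
by apply: eq_bigr => i _; rewrite mxE.
Qed.

(** A nonzero [v] in the left kernel would satisfy [b v v = 0], against positivity. *)
Lemma gram_unit : gram \in unitmx.
Proof.
rewrite unitmxE unitfE; apply/negP => /det0P [v v0 vG].
have := b_pos v0; rewrite (linear_form_expand v (inner_product_linear_r v)).
rewrite big1 ?ltxx // => j _.
by rewrite -mul_gram vG mxE mulr0.
Qed.

Lemma gram_solve (l c : 'rV[R]_n) :
  (forall j, b c (delta_mx ord0 j) = l ord0 j) -> c = l *m invmx gram.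
Proof.
move=> cl; apply: (canRL (mulmxK gram_unit)); apply/rowP => j.
by rewrite mul_gram.
Qed.

(** This supplies the witnesses for the choices that define [tan_part] and [weingarten]. *)
Lemma riesz (l : 'rV[R]_n -> R) : linear (l : _ -> R^o) ->
  exists X, forall Y, b X Y = l Y.
Proof.
move=> linl; exists ((\row_j l (delta_mx ord0 j)) *m invmx gram) => Y.
rewrite (linear_form_expand Y linl) (linear_form_expand Y (inner_product_linear_r _)).
apply: eq_bigr => j _.
by rewrite -mul_gram (mulmxKV gram_unit) mxE.
Qed.

Lemma inner_product_inj X X' : (forall Y, b X Y = b X' Y) -> X = X'.
Proof.
move=> XX'; apply/eqP; rewrite -subr_eq0; apply/negP => /negP /b_pos.
by rewrite (linear_funB (b_linear _)) XX' subrr ltxx.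
Qed.

End InnerProduct.

(** * Smoothness of determinants, matrix products and inverses *)

Section SmoothInverse.
Variables (R : realType) (m : nat) (M : manifold R m) (p : M).

Lemma smooth_near_det k (A : M -> 'M[R]_k) :
  (forall i j, smooth_near p (fun q => A q i j : R^o)) ->
  smooth_near p (fun q => \det (A q) : R^o).
Proof.
move=> sA; apply: smooth_near_sum => s _.
apply: smooth_near_mul; first exact: smooth_near_cst.
have sf i : smooth_near p (fun q => A q i (perm.fun_of_perm s i) : R^o) by exact: sA.
exact: (smooth_near_prod (index_enum _) sf).
Qed.

Lemma smooth_near_mulmx j k l (A : M -> 'M[R]_(j, k)) (B : M -> 'M[R]_(k, l)) :
  smooth_near p A -> smooth_near p B -> smooth_near p (fun q => A q *m B q).
Proof.
move=> sA sB; apply: smooth_near_mx => x y.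
apply: smooth_near_ext (smooth_near_sum (index_enum _) (P := xpredT)
  (f := fun i q => A q x i * B q i y : R^o) _) => [|i _].
  by apply: nearW => q; rewrite mxE.
by apply: smooth_near_mul; exact: smooth_near_coord.
Qed.

(** Cramer's formula writes the inverse as the adjugate over the determinant, which are polynomial
    in the entries. *)
Lemma smooth_near_invmx k (A : M -> 'M[R]_k) :
  (\forall q \near p, A q \in unitmx) -> smooth_near p A ->
  smooth_near p (fun q => invmx (A q)).
Proof.
move=> uA sA.
apply: (@smooth_near_ext _ _ _ _ _ (fun q => (\det (A q))^-1 *: \adj (A q))).
  by apply: filterS uA => q uAq; rewrite /invmx uAq.
have sAij i j : smooth_near p (fun q => A q i j : R^o) by exact: smooth_near_coord.
apply: smooth_near_scale.
  apply: smooth_near_inv; last exact: smooth_near_det.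
  by apply: filterS uA => q; rewrite unitmxE unitfE.
apply: smooth_near_mx => i j.
apply: (@smooth_near_ext _ _ _ _ _
  (fun q => (-1) ^+ (j + i) * \det (row' j (col' i (A q))) : R^o)).
  by apply: nearW => q; rewrite mxE.
apply: smooth_near_mul; first exact: smooth_near_cst.
apply: smooth_near_det => x y; apply: smooth_near_ext (sAij (lift j x) (lift i y)).
by apply: nearW => q; rewrite !mxE.
Qed.

End SmoothInverse.

Lemma sub_linear_comb (R : pzRingType) (V : lmodType R) a (u v x y : V) :
  a *: u + v - (a *: x + y) = a *: (u - x) + (v - y).
Proof. by rewrite scalerBr opprD addrACA. Qed.

Section TangentPart.
Variables (R : realType) (m n : nat) (M : manifold R m) (N : manifold R n).
Variables (iota : N -> M) (immN : is_immersion iota).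
Variables (g : M -> 'rV[R]_m -> 'rV[R]_m -> R) (riem_g : is_riemannian g).
Implicit Types (p q : N) (X Y Z : 'rV[R]_n) (u v w : 'rV[R]_m).

Local Notation gN := (induced_metric iota g).
Local Notation T := (tangent_map iota).
Local Notation tan := (tan_part iota g).
Local Notation nor := (nor_part iota g).
Local Notation normal := (is_normal iota g).

Lemma induced_linear p Y : linear (fun X => gN p X Y : R^o).
Proof.
move=> a X X'; rewrite /induced_metric (tangent_map_linear immN).
exact: metric_linear_l.
Qed.

Lemma induced_sym p X Y : gN p X Y = gN p Y X.
Proof. exact: (Defs.metric_sym riem_g). Qed.

(** Definiteness comes from the injectivity of the differential of [iota]. *)
Lemma induced_pos p X : X != 0 -> 0 < gN p X X.
Proof.
move=> X0; apply: (metric_pos riem_g); apply: contra_neq X0 => TX0.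
apply: (imm_injective immN (p := p)).
by rewrite TX0 (linear_fun0 (tangent_map_linear immN p)).
Qed.

Lemma induced_inj p X X' : (forall Y, gN p X Y = gN p X' Y) -> X = X'.
Proof. by apply: inner_product_inj; [exact: induced_linear|exact: induced_pos]. Qed.

Lemma inducedBl p X Y Z : gN p (X - Y) Z = gN p X Z - gN p Y Z.
Proof. exact: (linear_funB (induced_linear p Z)). Qed.

Lemma inducedNl p X Z : gN p (- X) Z = - gN p X Z.
Proof. exact: (linear_funN (induced_linear p Z)). Qed.

Lemma induced0l p Z : gN p 0 Z = 0.
Proof. exact: (linear_fun0 (induced_linear p Z)). Qed.

Lemma metric_T_linear p w : linear (fun X => g (iota p) w (T p X) : R^o).
Proof.
by move=> a X Y; rewrite (tangent_map_linear immN); exact: (metric_linear_r riem_g).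
Qed.

Lemma metricBl r u v w : g r (u - v) w = g r u w - g r v w.
Proof. exact: (linear_funB (metric_linear_l riem_g r w)). Qed.

Lemma metricDl r u v w : g r (u + v) w = g r u w + g r v w.
Proof. exact: (linear_funD (metric_linear_l riem_g r w)). Qed.

Lemma metricNl r u w : g r (- u) w = - g r u w.
Proof. exact: (linear_funN (metric_linear_l riem_g r w)). Qed.

Lemma metricC r u v : g r u v = g r v u.
Proof. exact: (Defs.metric_sym riem_g). Qed.

(** Riesz, applied to the form [g (iota p) w (T p Y)] in [Y], shows that the choice in [tan_part] is
    not the default. From here on [tan_part] is used only through this pairing. *)
Lemma tan_partE p w Y : gN p (tan p w) Y = g (iota p) w (T p Y).
Proof.
have [X XE] := riesz (@induced_linear p) (induced_sym p) (@induced_pos p)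
  (metric_T_linear p w).
suff nw : normal p (w - T p (tan p w)).
  by apply/eqP; rewrite eq_sym -subr_eq0 -metricBl nw.
apply: (@xgetPex _ 0 [set X | normal p (w - T p X)]); exists X => Y' /=.
by rewrite metricBl -XE subrr.
Qed.

Lemma tan_part_unique p w X :
  (forall Y, g (iota p) w (T p Y) = gN p X Y) -> tan p w = X.
Proof. by move=> wX; apply: (@induced_inj p) => Y; rewrite tan_partE. Qed.

Lemma tan_part_linear p : linear (tan p).
Proof.
move=> a u v; apply: tan_part_unique => Y.
by rewrite induced_linear (metric_linear_l riem_g) !tan_partE.
Qed.

Lemma tan_part_tangent p X : tan p (T p X) = X.
Proof. exact: tan_part_unique. Qed.

Lemma nor_part_normal p w : normal p (nor p w).
Proof.
move=> X; have := tan_partE p w X; rewrite /induced_metric => wE.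
by rewrite /nor_part metricBl wE subrr.
Qed.

Lemma nor_part_linear p : linear (nor p).
Proof.
move=> a u v; rewrite /nor_part tan_part_linear (tangent_map_linear immN).
exact: sub_linear_comb.
Qed.

Lemma nor_part_tangent p X : nor p (T p X) = 0.
Proof. by rewrite /nor_part tan_part_tangent subrr. Qed.

Lemma tan_nor_part p w : w = T p (tan p w) + nor p w.
Proof. by rewrite /nor_part addrC subrK. Qed.

(** The difference [u - v] is itself normal, so it may serve as its own test vector. *)
Lemma metric_normal_inj p u v : normal p u -> normal p v ->
  (forall w, normal p w -> g (iota p) u w = g (iota p) v w) -> u = v.
Proof.
move=> nu nv uv; apply/eqP; rewrite -subr_eq0; apply/negP => /negP.
move=> /(metric_pos riem_g (iota p)); rewrite metricBl uv ?subrr ?ltxx //.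
by move=> X; rewrite metricBl nu nv subrr.
Qed.

Variable nabla : M -> 'rV[R]_m -> (M -> 'rV[R]_m) -> 'rV[R]_m.
Hypothesis lc_nabla : is_levi_civita g nabla.

Lemma tan_partD p u v : tan p (u + v) = tan p u + tan p v.
Proof. exact: (linear_funD (tan_part_linear p)). Qed.

Lemma nor_partB p u v : nor p (u - v) = nor p u - nor p v.
Proof. exact: (linear_funB (nor_part_linear p)). Qed.

Lemma nor_partD p u v : nor p (u + v) = nor p u + nor p v.
Proof. exact: (linear_funD (nor_part_linear p)). Qed.

Lemma induced_metric_along p X (Y Z : N -> 'rV[R]_n) :
  smooth_field_near p Y -> smooth_field_near p Z ->
  dir_deriv p X (fun q => gN q (Y q) (Z q) : R^o) =
    gN p (tan p (conn_along iota nabla p X (fun q => T q (Y q)))) (Z p) +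
    gN p (tan p (conn_along iota nabla p X (fun q => T q (Z q)))) (Y p).
Proof.
move=> sY sZ; apply: etrans (metric_along immN riem_g lc_nabla X
  (smooth_along_tangent immN sY) (smooth_along_tangent immN sZ)).2 _.
apply: congr_add; first by rewrite tan_partE.
by rewrite tan_partE; exact: metricC.
Qed.

Lemma smooth_tan_part p (V : N -> 'rV[R]_m) : smooth_along iota p V ->
  smooth_field_near p (fun q => tan q (V q)).
Proof.
move=> sV; pose e i q := coord_field p (delta_mx ord0 i) q.
have sTe i : smooth_along iota p (fun q => T q (e i q)).
  exact: (smooth_along_tangent immN (smooth_field_near_coord _ _)).
(* [b q] is the induced metric at [q] in the coordinates of the chart at [p], and [l q] is the
   right-hand side of the system. Its solution is [components p q (tan q (V q))], the function whose
   smoothness is claimed. *)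
pose b q c c' := gN q (coord_field p c q) (coord_field p c' q).
pose l q : 'rV[R]_n := \row_j g (iota q) (V q) (T q (e j q)).
have smooth_g V1 V2 : smooth_along iota p V1 -> smooth_along iota p V2 ->
    smooth_near p (fun q => g (iota q) (V1 q) (V2 q) : R^o).
  (* The direction 0 is arbitrary: only the smoothness half of [metric_rule] is extracted. *)
  by move=> s1 s2; case: (metric_along immN riem_g lc_nabla 0 s1 s2).
have bP q : domain p q -> [/\ forall c', linear (fun c => b q c c' : R^o),
    forall c c', b q c c' = b q c' c & forall c, c != 0 -> 0 < b q c c].
  move=> pq; split=> [c' a c d|c c'|c c0]; rewrite /b.
  - by rewrite (coord_field_linear pq); exact: induced_linear.
  - exact: induced_sym.
  - apply: induced_pos; apply: contra_neq c0 => c0.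
    rewrite -(coord_fieldK c pq) c0.
    exact: (linear_fun0 (components_linear pq)).
apply: (@smooth_near_ext _ _ _ _ _ (fun q => l q *m invmx (gram (b q)))).
  apply: filterS (near_domain (domain_self p)) => q pq; have [b1 b2 b3] := bP q pq.
  symmetry; apply: gram_solve => // j.
  by rewrite mxE /b (componentsK _ pq) tan_partE.
apply: smooth_near_mulmx.
  apply: smooth_near_mx => i j.
  apply: smooth_near_ext (smooth_g _ _ sV (sTe j)).
  by apply: nearW => q; rewrite mxE.
apply: smooth_near_invmx.
  apply: filterS (near_domain (domain_self p)) => q pq; have [b1 b2 b3] := bP q pq.
  exact: gram_unit.
apply: smooth_near_mx => i j.
apply: smooth_near_ext (smooth_g _ _ (sTe i) (sTe j)).
by apply: nearW => q; rewrite mxE.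
Qed.

End TangentPart.

(** * Gauss and Weingarten formulas *)

Local Opaque tangent_map induced_metric tan_part nor_part conn_along.

Lemma addr_subKr (V : zmodType) (a b c : V) : a + c - (b + c) = a - b.
Proof. by rewrite opprD addrACA subrr addr0. Qed.

Lemma subr_exchange (V : zmodType) (a b c d : V) : a - b = c - d -> a - c = b - d.
Proof.
by move=> abcd; rewrite -[a](subrK b) abcd addrAC [c - d]addrC addrK addrC.
Qed.

Lemma subr_exchange2 (V : zmodType) (a b c d : V) : a + b = c + d -> a - c = d - b.
Proof. by move=> abcd; rewrite -[a](addrK b) abcd [c + d]addrC addrAC addrK. Qed.

(** Six alternating exchanges of neighbouring arguments return to the original order, and three of
    them change the sign. [P] will be smoothness of fields, asked only of the arguments that each
    symmetry differentiates. *)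
Lemma symmetric_skew_eq0 (R : realType) (I : Type) (P : I -> Prop)
    (d : I -> I -> I -> R) :
  (forall x y z, P x -> P y -> d x y z = d y x z) ->
  (forall x y z, P y -> P z -> d x y z = - d x z y) ->
  forall x y z, P x -> P y -> P z -> d x y z = 0.
Proof.
move=> dC dN x y z Px Py Pz.
have E : d x y z = - d x y z.
  rewrite {1}(dC x y z) // (dN y x z) // (dC y z x) // (dN z y x) //.
  by rewrite (dC z x y) // (dN x z y) // !opprK.
by lra.
Qed.

(** * Torsion-freeness tested on coordinate functions *)

Section TorsionFree.
Variables (R : realType) (m : nat) (M : manifold R m).
Variables (g : M -> 'rV[R]_m -> 'rV[R]_m -> R).
Variable nabla : M -> 'rV[R]_m -> (M -> 'rV[R]_m) -> 'rV[R]_m.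
Hypothesis lc_nabla : is_levi_civita g nabla.

(** Vector values are needed to take for [f] a chart map, or a chart map of M composed with [iota]:
    testing on these recovers the vector itself or its image under [tangent_map]. *)
Lemma torsion_free_mx k (p : M) (X Y : M -> 'rV[R]_m) (f : M -> 'rV[R]_k) :
  smooth_field_near p X -> smooth_field_near p Y -> smooth_near p f ->
  dir_deriv p (nabla p (X p) Y - nabla p (Y p) X) f =
  dir_deriv p (X p) (fun q => dir_deriv q (Y q) f) -
  dir_deriv p (Y p) (fun q => dir_deriv q (X q) f).
Proof.
move=> sX sY sf; apply/rowP => i.
have dE (Z : M -> 'rV[R]_m) u : smooth_field_near p Z ->
    dir_deriv p u (fun q => dir_deriv q (Z q) (fun q' => f q' ord0 i : R^o)) =
    dir_deriv p u (fun q => dir_deriv q (Z q) f) ord0 i.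
  move=> sZ; rewrite -dir_deriv_coord; last exact: smooth_near_dir_deriv.
  apply: dir_deriv_ext; apply: filterS (near_smooth_differentiable sf) => q.
  exact: dir_deriv_coord_differentiable.
rewrite -dir_deriv_coord // (lc_torsion_free lc_nabla sX sY);
  last exact: smooth_near_coord.
by rewrite (dE _ _ sX) (dE _ _ sY) !mxE.
Qed.

Lemma coord_field_components (p : M) w : \forall q \near p,
  components p q (coord_field p w q) = w.
Proof. by apply: filterS (near_domain (domain_self p)) => q; exact: coord_fieldK. Qed.

Lemma conn_coord_field p u w : nabla p w (coord_field p u) =
  \sum_k u ord0 k *: nabla p w (coord_field p (delta_mx ord0 k)).
Proof.
rewrite (conn_expand (lc_connection lc_nabla) w (smooth_field_near_coord p u)).
rewrite (dir_deriv_ext w (coord_field_components p u)) dir_deriv_cst add0r.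
by rewrite coord_field_self.
Qed.

(** This is the symmetry of the Christoffel symbols. With [f := phi p] the second derivatives
    vanish, since coordinate fields have constant components, and the derivative of [phi p] along a
    vector is that vector. *)
Lemma conn_coord_field_sym p u v :
  nabla p u (coord_field p v) = nabla p v (coord_field p u).
Proof.
have sc w := smooth_field_near_coord p w.
have dd0 w w' : dir_deriv p w
    (fun q => dir_deriv q (coord_field p w' q) (phi p)) = 0.
  have E : \forall q \near p, dir_deriv q (coord_field p w' q) (phi p) = w'.
    exact: coord_field_components.
  by rewrite (dir_deriv_ext w E) dir_deriv_cst.
have dphi w : dir_deriv p w (phi p) = w := components_self p w.
have E : nabla p (coord_field p u p) (coord_field p v) -
    nabla p (coord_field p v p) (coord_field p u) = 0.
  apply: etrans (esym (dphi _)) _.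
  apply: etrans (torsion_free_mx (sc u) (sc v) (smooth_near_phi p)) _.
  by rewrite (dd0 _ v) (dd0 _ u) subrr.
by move: E; rewrite (coord_field_self p u) (coord_field_self p v); exact: subr0_eq.
Qed.

End TorsionFree.

Section Submanifold.
Variables (R : realType) (m n : nat) (M : manifold R m).
Variable g : M -> 'rV[R]_m -> 'rV[R]_m -> R.
Variable nablaM : M -> 'rV[R]_m -> (M -> 'rV[R]_m) -> 'rV[R]_m.
Hypotheses (riem_g : is_riemannian g) (lcM : is_levi_civita g nablaM).
Variables (N : manifold R n) (iota : N -> M).
Hypothesis immN : is_immersion iota.
Variable nablaN : N -> 'rV[R]_n -> (N -> 'rV[R]_n) -> 'rV[R]_n.
Hypothesis lcN : is_levi_civita (induced_metric iota g) nablaN.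
Implicit Types (p q : N).

Local Notation gN := (induced_metric iota g).
Local Notation T := (tangent_map iota).
Local Notation tan := (tan_part iota g).
Local Notation nor := (nor_part iota g).
Local Notation normal := (is_normal iota g).
Local Notation h := (second_fundamental_form iota g nablaM).
Local Notation A := (weingarten iota g nablaM).
Local Notation DM := (conn_along iota nablaM).
Local Notation DT p X Z :=
  (conn_along iota nablaM p X (fun q => tangent_map iota q (Z q))).

(** [DT] is a second derivative of [phi (iota p) \o iota] plus a Christoffel term of M. The
    Christoffel terms cancel by symmetry, and the second derivatives give [T] of the torsion
    expression of [nablaN]. *)
Lemma conn_along_torsion_free p (X Y : N -> 'rV[R]_n) :
  smooth_field_near p X -> smooth_field_near p Y ->
  DT p (X p) Y - DT p (Y p) X = T p (nablaN p (X p) Y - nablaN p (Y p) X).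
Proof.
move=> sX sY; rewrite (tangent_mapE iota p (_ - _)).
rewrite (torsion_free_mx lcN sX sY (imm_smooth immN p)).
have DE (Z : N -> 'rV[R]_n) u : DT p u Z =
    dir_deriv p u (fun q => dir_deriv q (Z q) (phi (iota p) \o iota)) +
    nablaM (iota p) (T p u) (coord_field (iota p) (T p (Z p))).
  rewrite conn_alongE (conn_coord_field lcM); apply: congr_add; last by [].
  apply: dir_deriv_ext; apply: filterS (near_domain_iota immN p) => q pq.
  by rewrite (components_tangent_map immN).
rewrite (DE Y (X p)) (DE X (Y p)).
rewrite (conn_coord_field_sym lcM (iota p) (T p (Y p)) (T p (X p))).
exact: addr_subKr.
Qed.

Lemma gauss_formula p X (Y : N -> 'rV[R]_n) : smooth_field_near p Y ->
  nablaN p X Y = tan p (DT p X Y).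
Proof.
(* The arguments of [d] are fields, so the symmetry argument runs without first proving that [d]
   depends on [Y] only through [Y p]. *)
pose d (X Y Z : N -> 'rV[R]_n) := gN p (nablaN p (X p) Y - tan p (DT p (X p) Y)) (Z p).
have d_sym X' Y' Z' : smooth_field_near p X' -> smooth_field_near p Y' ->
    d X' Y' Z' = d Y' X' Z'.
  move=> sX sY; rewrite /d; apply: (f_equal (fun w => gN p w (Z' p))).
  apply: subr_exchange; rewrite -(linear_funB (tan_part_linear immN riem_g p)).
  by rewrite (conn_along_torsion_free sX sY) (tan_part_tangent immN riem_g).
have d_skew X' Y' Z' : smooth_field_near p Y' -> smooth_field_near p Z' ->
    d X' Y' Z' = - d X' Z' Y'.
  move=> sY sZ.
  have dE Y1 Z1 : d X' Y1 Z1 =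
      gN p (nablaN p (X' p) Y1) (Z1 p) - gN p (tan p (DT p (X' p) Y1)) (Z1 p).
    exact: (inducedBl immN riem_g).
  apply: etrans (dE Y' Z') _; apply: etrans (esym (f_equal (-%R) (dE Z' Y'))).
  rewrite opprB; apply: subr_exchange2.
  apply: etrans _ (induced_metric_along immN riem_g lcM (X' p) sY sZ).
  apply: etrans _ (esym (lc_metric lcN (X' p) sY sZ)).
  by apply: congr_add; last exact: (induced_sym iota riem_g).
move=> sY; apply: subr0_eq; apply: (induced_inj immN riem_g (p := p)) => Z.
rewrite (induced0l immN riem_g).
have sX := smooth_field_near_coord p X; have sZ := smooth_field_near_coord p Z.
have := symmetric_skew_eq0 d_sym d_skew sX sY sZ.
by rewrite /d !coord_field_self.
Qed.

(** The antisymmetric part of [DT] is tangent to N, being in the image of [T]. *)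
Lemma normal_part_sym p (X Y : N -> 'rV[R]_n) :
  smooth_field_near p X -> smooth_field_near p Y ->
  nor p (DT p (X p) Y) = nor p (DT p (Y p) X).
Proof.
move=> sX sY; apply: subr0_eq; rewrite -(nor_partB immN riem_g).
by rewrite (conn_along_torsion_free sX sY) (nor_part_tangent immN riem_g).
Qed.

Lemma second_fundamental_formE p X (Z : N -> 'rV[R]_n) : smooth_field_near p Z ->
  h p X (Z p) = nor p (DT p X Z).
Proof.
suff hP Y : forall Z : N -> 'rV[R]_n, smooth_field_near p Z -> Z p = Y ->
    h p X Y = nor p (DT p X Z) by move=> sZ; exact: hP.
apply: (@xgetPex _ 0 [set w | forall Z : N -> 'rV[R]_n,
  smooth_field_near p Z -> Z p = Y -> w = nor p (DT p X Z)]).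
(* The witness has the two arguments exchanged: it extends [X] and differentiates along [Y], so no
   extension of [Y] enters. Symmetry equates it with the value computed from any extension [Z'] of
   [Y]. *)
exists (nor p (DT p Y (coord_field p X))) => Z' sZ' <-.
have sX := smooth_field_near_coord p X.
have E := normal_part_sym sX sZ'; rewrite (coord_field_self p X) in E.
exact: esym E.
Qed.

Lemma second_fundamental_form_coord p X Y :
  h p X Y = nor p (DT p X (coord_field p Y)).
Proof.
by rewrite -(second_fundamental_formE X (smooth_field_near_coord p Y)) coord_field_self.
Qed.

Lemma second_fundamental_form_sym p X Y : h p X Y = h p Y X.
Proof.
have sX := smooth_field_near_coord p X; have sY := smooth_field_near_coord p Y.
rewrite !second_fundamental_form_coord; have := normal_part_sym sX sY.
by rewrite !coord_field_self.
Qed.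

Lemma second_fundamental_form_normal p X Y : normal p (h p X Y).
Proof.
by rewrite second_fundamental_form_coord; exact: (nor_part_normal immN riem_g).
Qed.

Lemma second_fundamental_form_linear p Y : linear (h p ^~ Y).
Proof.
move=> a X X'; rewrite !second_fundamental_form_coord.
have sY := smooth_along_tangent immN (smooth_field_near_coord p Y).
rewrite (conn_along_linear immN (lc_connection lcM) sY).
exact: (nor_part_linear immN riem_g).
Qed.

Lemma gauss_decomposition p X (Y : N -> 'rV[R]_n) : smooth_field_near p Y ->
  DT p X Y = T p (nablaN p X Y) + h p X (Y p).
Proof.
move=> sY; rewrite (gauss_formula _ sY) (second_fundamental_formE _ sY).
exact: tan_nor_part.
Qed.

(** Riesz needs linearity of [h] in its second argument; symmetry reduces it to linearity in the
    first, the direction of differentiation. *)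
Lemma weingartenE p xi X Y : gN p (A p xi X) Y = g (iota p) (h p X Y) xi.
Proof.
apply: (@xgetPex _ 0 [set Z | forall Y, gN p Z Y = g (iota p) (h p X Y) xi]).
apply: (riesz (induced_linear immN riem_g p) (induced_sym iota riem_g p)
  (fun Z Z0 => induced_pos immN riem_g p Z0)) => a Y1 Y2.
rewrite !(second_fundamental_form_sym _ X) second_fundamental_form_linear.
exact: (metric_linear_l riem_g).
Qed.

Lemma weingarten_sym p xi X Y : gN p (A p xi X) Y = gN p (A p xi Y) X.
Proof.
apply: etrans (weingartenE p xi X Y) (etrans _ (esym (weingartenE p xi Y X))).
by rewrite (second_fundamental_form_sym p X).
Qed.

Lemma tan_part_conn_normal p X (xi : N -> 'rV[R]_m) : smooth_along iota p xi ->
  (\forall q \near p, normal q (xi q)) ->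
  tan p (DM p X xi) = - A p (xi p) X.
Proof.
move=> sxi nxi; apply: (tan_part_unique immN riem_g) => Y.
have sY := smooth_field_near_coord p Y.
rewrite (inducedNl immN riem_g) weingartenE.
have [_ E] := metric_along immN riem_g lcM X sxi (smooth_along_tangent immN sY).
have gE : \forall q \near p,
    (g (iota q) (xi q) (T q (coord_field p Y q)) : R^o) = 0.
  by apply: filterS nxi => q; apply.
move: E; rewrite (dir_deriv_ext X gE) dir_deriv_cst (gauss_decomposition X sY).
rewrite (linear_funD (metric_linear_r riem_g _ _)) (nbhs_singleton nxi) add0r.
rewrite !coord_field_self (metricC riem_g (iota p) (h p X Y)) => E.
by apply/eqP; rewrite -subr_eq0 opprK -E.
Qed.

End Submanifold.

(** * Submanifolds of Kaehlerian manifolds *)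

Local Opaque second_fundamental_form weingarten.

Lemma subr_transpose (V : zmodType) (a b c d : V) : a + b = c - d -> c - a = b + d.
Proof. by move=> abcd; rewrite -[c](subrK d) -abcd addrAC [a + b]addrC addrK. Qed.

Lemma subr_exchange3 (V : zmodType) (a b c d : V) : a + b = c + d -> d - a = b - c.
Proof. by move=> abcd; rewrite -[b](addKr a) abcd addrCA [c + _]addrC addrK addrC. Qed.

Lemma oppr_add_eq0 (V : zmodType) (a b : V) : - a + b = 0 -> a = b.
Proof. by move/eqP; rewrite addrC subr_eq0 eq_sym => /eqP. Qed.

Section Kaehler.
Variables (R : realType) (m n : nat) (M : manifold R m).
Variables (g : M -> 'rV[R]_m -> 'rV[R]_m -> R) (J : M -> 'rV[R]_m -> 'rV[R]_m).
Variable nablaM : M -> 'rV[R]_m -> (M -> 'rV[R]_m) -> 'rV[R]_m.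
Hypothesis kaehlerM : is_kaehlerian g J nablaM.
Variables (N : manifold R n) (iota : N -> M).
Hypothesis immN : is_immersion iota.
Variable nablaN : N -> 'rV[R]_n -> (N -> 'rV[R]_n) -> 'rV[R]_n.
Hypothesis lcN : is_levi_civita (induced_metric iota g) nablaN.
Implicit Types (p q : N).

Local Notation gN := (induced_metric iota g).
Local Notation T := (tangent_map iota).
Local Notation tan := (tan_part iota g).
Local Notation nor := (nor_part iota g).
Local Notation normal := (is_normal iota g).
Local Notation h := (second_fundamental_form iota g nablaM).
Local Notation A := (weingarten iota g nablaM).
Local Notation DM := (conn_along iota nablaM).
Local Notation DT p X Z :=
  (conn_along iota nablaM p X (fun q => tangent_map iota q (Z q))).
Local Notation P := (P_op iota g J).
Local Notation F := (F_op iota g J).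
Local Notation t := (t_op iota g J).
Local Notation f := (f_op iota g J).

Let riem_g := kaehler_riemannian kaehlerM.
Let lcM := kaehler_levi_civita kaehlerM.

(** Apply [J] to both arguments and use that its square is minus the identity. *)
Lemma J_skew r u v : g r (J r u) v = - g r u (J r v).
Proof.
by rewrite -(kaehler_hermitian kaehlerM) (kaehler_square kaehlerM) (metricNl riem_g).
Qed.

Lemma JD r u v : J r (u + v) = J r u + J r v.
Proof. exact: (linear_funD (kaehler_linear kaehlerM r)). Qed.

Lemma J_tangent p X : J (iota p) (T p X) = T p (P p X) + F p X.
Proof. exact: tan_nor_part. Qed.

Lemma smooth_along_JT p (Y : N -> 'rV[R]_n) : smooth_field_near p Y ->
  smooth_along iota p (fun q => J (iota q) (T q (Y q))).
Proof.
by move=> sY; apply: (smooth_along_J immN kaehlerM); exact: smooth_along_tangent.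
Qed.

Lemma smooth_P p (Y : N -> 'rV[R]_n) : smooth_field_near p Y ->
  smooth_field_near p (fun q => P q (Y q)).
Proof. by move=> sY; exact: (smooth_tan_part immN riem_g lcM (smooth_along_JT sY)). Qed.

(** This form reduces smoothness of [F Y] to that of [J T Y] and [P Y]. *)
Lemma F_opE p X : F p X = J (iota p) (T p X) - T p (P p X).
Proof. by rewrite J_tangent addrC addKr. Qed.

Lemma smooth_along_F p (Y : N -> 'rV[R]_n) : smooth_field_near p Y ->
  smooth_along iota p (fun q => F q (Y q)).
Proof.
move=> sY; have sTP := smooth_along_tangent immN (smooth_P sY).
apply: smooth_along_ext (smooth_along_add immN (smooth_along_JT sY)
  (smooth_along_opp immN sTP)).
by apply: nearW => q; rewrite F_opE.
Qed.

Lemma F_normal p X : normal p (F p X).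
Proof. exact: (nor_part_normal immN riem_g). Qed.

Lemma conn_along_JT p X (Y : N -> 'rV[R]_n) : smooth_field_near p Y ->
  J (iota p) (T p (nablaN p X Y)) + J (iota p) (h p X (Y p)) =
  DT p X (fun q => P q (Y q)) + DM p X (fun q => F q (Y q)).
Proof.
move=> sY; have sTP := smooth_along_tangent immN (smooth_P sY).
rewrite -JD -(gauss_decomposition riem_g lcM immN lcN X sY).
rewrite -(conn_along_J immN lcM kaehlerM X (smooth_along_tangent immN sY)).
rewrite -(conn_along_add immN nablaM X sTP (smooth_along_F sY)).
by apply: conn_along_ext; apply: nearW => q; exact: J_tangent.
Qed.

Lemma nabla_P_formula p X (Y : N -> 'rV[R]_n) : smooth_field_near p Y ->
  nabla_P iota g J nablaN p X Y = t p (h p X (Y p)) + A p (F p (Y p)) X.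
Proof.
move=> sY; apply: subr_transpose.
apply: etrans (esym (tan_partD immN riem_g p _ _)) _.
apply: etrans (f_equal (tan p) (conn_along_JT X sY)) _.
apply: etrans (tan_partD immN riem_g p _ _) _; apply: congr_add.
  exact: esym (gauss_formula riem_g lcM immN lcN X (smooth_P sY)).
apply: (tan_part_conn_normal riem_g lcM immN lcN X (smooth_along_F sY)).
by apply: nearW => q; exact: F_normal.
Qed.

Lemma nabla_F_formula p X (Y : N -> 'rV[R]_n) : smooth_field_near p Y ->
  nabla_F iota g J nablaM nablaN p X Y = f p (h p X (Y p)) - h p X (P p (Y p)).
Proof.
move=> sY; apply: subr_exchange3.
apply: etrans (esym (nor_partD immN riem_g p _ _)) _.
apply: etrans (f_equal (nor p) (conn_along_JT X sY)) _.
apply: etrans (nor_partD immN riem_g p _ _) _; apply: congr_add; last by [].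
exact: esym (second_fundamental_formE riem_g lcM immN lcN X (smooth_P sY)).
Qed.

(** Skewness moves [J] onto [T Z], whose tangential part [T P Z] is orthogonal to [h]; what remains
    is the pairing of [h] with [F Z], that is, a Weingarten map. *)
Lemma induced_t p X Y Z :
  gN p (t p (h p X Y)) Z = - gN p (A p (F p Z) Y) X.
Proof.
rewrite (tan_partE immN riem_g) J_skew J_tangent.
rewrite (linear_funD (metric_linear_r riem_g _ _)).
rewrite (second_fundamental_form_normal riem_g lcM immN lcN) add0r.
rewrite (weingartenE riem_g lcM immN lcN).
by rewrite (second_fundamental_form_sym riem_g lcM immN lcN p X).
Qed.

Lemma nabla_P_eq0 :
  (forall p X Y, smooth_field_near p Y -> nabla_P iota g J nablaN p X Y = 0) <->
  (forall p X Y, A p (F p X) Y = A p (F p Y) X).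
Proof.
(* After pairing, the direction of differentiation [X] becomes the test vector of
   [A_{FY} Z - A_{FZ} Y], because [A] is self-adjoint. Both implications read off this identity. *)
have tA p X Y Z : gN p (t p (h p X Y) + A p (F p Y) X) Z =
    - gN p (A p (F p Z) Y) X + gN p (A p (F p Y) Z) X.
  rewrite (linear_funD (induced_linear immN riem_g p Z)) induced_t.
  by apply: congr_add; last exact: (weingarten_sym riem_g lcM immN lcN).
split=> [nP0 p X Y|AF p X Y sY].
  apply: (induced_inj immN riem_g (p := p)) => Z.
  have sY := smooth_field_near_coord p Y.
  have E0 : t p (h p Z Y) + A p (F p Y) Z = 0.
    apply: etrans _ (nP0 p Z _ sY); apply: etrans _ (esym (nabla_P_formula Z sY)).
    by rewrite coord_field_self.
  by have := tA p Z Y X; rewrite E0 (induced0l immN riem_g) => /esym/oppr_add_eq0.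
rewrite nabla_P_formula //; apply: (induced_inj immN riem_g (p := p)) => Z.
apply: etrans (tA p X (Y p) Z) _.
apply: etrans (f_equal (fun W => - gN p W X + _) (AF p Z (Y p))) _.
apply: etrans (addNr _) _; exact: esym (induced0l immN riem_g p Z).
Qed.

(** Against a normal vector [f] may be replaced by [J], so [f] is skew on normal vectors; the
    definition of [A] then gives the formula. *)
Lemma metric_f p X Y xi : normal p xi ->
  g (iota p) (f p (h p X Y)) xi = - gN p (A p (f p xi) X) Y.
Proof.
move=> nxi; have gf u v : normal p v ->
    g (iota p) (f p u) v = g (iota p) (J (iota p) u) v.
  move=> nv; rewrite [in RHS](tan_nor_part iota g p (J (iota p) u)) (metricDl riem_g).
  by rewrite (metricC riem_g _ (T p _)) nv add0r.
rewrite gf // J_skew (weingartenE riem_g lcM immN lcN); congr (- _).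
rewrite !(metricC riem_g _ (h p X Y)) gf //.
exact: (second_fundamental_form_normal riem_g lcM immN lcN).
Qed.

(** Pairing (nabla_Y F) X with a normal [xi] gives minus the pairing of [A_{f xi} X + A_xi (P X)]
    with [Y], by [metric_f] and the symmetry of [h]. *)
Lemma nabla_F_eq0 :
  (forall p X Y, smooth_field_near p Y ->
     nabla_F iota g J nablaM nablaN p X Y = 0) <->
  (forall p xi X, normal p xi -> A p (f p xi) X = - A p xi (P p X)).
Proof.
have h_sym := second_fundamental_form_sym riem_g lcM immN lcN.
have AE := weingartenE riem_g lcM immN lcN.
split=> [nF0 p xi X nxi|fA p X Y sY].
  apply: (induced_inj immN riem_g (p := p)) => Y.
  have sX := smooth_field_near_coord p X.
  have E : f p (h p Y X) = h p Y (P p X).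
    apply: subr0_eq; rewrite -[in LHS](coord_field_self p X).
    by rewrite -nabla_F_formula // nF0.
  have E' : g (iota p) (h p (P p X) Y) xi = - gN p (A p (f p xi) X) Y.
    by rewrite (h_sym p (P p X) Y) -E (h_sym p Y X) metric_f.
  apply: esym; apply: etrans (inducedNl immN riem_g p _ _) _.
  apply: etrans (f_equal (-%R) (etrans (AE _ _ _ _) E')) _; exact: opprK.
rewrite nabla_F_formula //; apply/eqP; rewrite subr_eq0; apply/eqP.
(* Both terms are normal, so it suffices to test their equality against normal vectors, the only
   ones that the hypothesis on [A] covers. *)
apply: (metric_normal_inj riem_g (p := p)).
- exact: (nor_part_normal immN riem_g).
- exact: (second_fundamental_form_normal riem_g lcM immN lcN).
move=> xi nxi; rewrite (h_sym p X (Y p)); apply: etrans (metric_f _ _ nxi) _.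
rewrite (fA p xi (Y p) nxi).
apply: etrans (f_equal (-%R) (inducedNl immN riem_g p _ _)) _.
by rewrite opprK; apply: etrans (AE _ _ _ _) _; rewrite (h_sym p X).
Qed.

End Kaehler.

Theorem lemma3p5 (R : realType) (m n : nat)
    (M : manifold R m)
    (g : M -> 'rV[R]_m -> 'rV[R]_m -> R) (J : M -> 'rV[R]_m -> 'rV[R]_m)
    (nablaM : M -> 'rV[R]_m -> (M -> 'rV[R]_m) -> 'rV[R]_m)
    (kaehlerM : is_kaehlerian g J nablaM)
    (N : manifold R n) (iota : N -> M) (immN : is_immersion iota)
    (nablaN : N -> 'rV[R]_n -> (N -> 'rV[R]_n) -> 'rV[R]_n)
    (lcN : is_levi_civita (induced_metric iota g) nablaN) :
  let P := P_op iota g J in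
  let F := F_op iota g J in
  let t := t_op iota g J in
  let f := f_op iota g J in
  let h := second_fundamental_form iota g nablaM in
  let A := weingarten iota g nablaM in
  let nablaP := nabla_P iota g J nablaN in
  let nablaF := nabla_F iota g J nablaM nablaN in
  ((forall (p : N) (X : 'rV[R]_n) (Y : N -> 'rV[R]_n),
      smooth_field_near p Y ->
      nablaP p X Y = t p (h p X (Y p)) + A p (F p (Y p)) X)
   /\
   ((forall (p : N) (X : 'rV[R]_n) (Y : N -> 'rV[R]_n),
       smooth_field_near p Y -> nablaP p X Y = 0)
    <->
    (forall (p : N) (X Y : 'rV[R]_n), A p (F p X) Y = A p (F p Y) X)))
  /\
  ((forall (p : N) (X : 'rV[R]_n) (Y : N -> 'rV[R]_n),
      smooth_field_near p Y ->
      nablaF p X Y = f p (h p X (Y p)) - h p X (P p (Y p)))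
   /\
   ((forall (p : N) (X : 'rV[R]_n) (Y : N -> 'rV[R]_n),
       smooth_field_near p Y -> nablaF p X Y = 0)
    <->
    (forall (p : N) (xi : 'rV[R]_m) (X : 'rV[R]_n),
       is_normal iota g p xi ->
       A p (f p xi) X = - A p xi (P p X)))).
Proof.
split; split.
- by move=> p X Y; exact: (nabla_P_formula kaehlerM immN lcN).
- exact: (nabla_P_eq0 kaehlerM immN lcN).
- by move=> p X Y; exact: (nabla_F_formula kaehlerM immN lcN).
- exact: (nabla_F_eq0 kaehlerM immN lcN).
Qed.
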